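(* Let $\mathcal V$ and $\mathcal W$ be finite dimensional subspaces of the Hilbert space $\mathcal H$ such that $\mathcal W^\perp\oplus\mathcal V=\mathcal H$, and let $d=\dim\mathcal V=\dim\mathcal W$. Let $\mathcal F=\{f_i\}_{i\in\mathbb I_n}$ be a frame for $\mathcal W$, and let $\lambda^\#_{\mathcal V}=(\lambda^\#_{\mathcal V,i})_{i\in\mathbb M}=\lambda(S_{\mathcal F^\#_{\mathcal V}})$. For every $t\ge\operatorname{tr}\lambda^\#_{\mathcal V}=\sum_i\lambda^\#_{\mathcal V,i}$ there exists $\nu\in\ell^1_+(\mathbb M)^\downarrow$ with the following minimality properties: 1. There exists $\mathcal G_{\rm op}\in\mathcal D_{\mathcal V,t}(\mathcal F)$ such that $\lambda(S_{\mathcal G_{\rm op}})=\nu$. 2. For every non-decreasing $h\in\mathrm{Conv}(\mathbb R_{\ge0})$, $$P_h(\mathcal G_{\rm op})\le P_h(\mathcal G)\quad\text{for every }\mathcal G=\{g_i\}_{i\in\mathbb I_n}\in\mathcal D_{\mathcal V,t}(\mathcal F).\qquad( * )$$ Moreover, if we assume further that $h$ is strictly convex (in addition to non-decreasing) and $\mathcal G=\{g_i\}_{i\in\mathbb I_n}\in\mathcal D_{\mathcal V,t}(\mathcal F)$ attains equality in $( * )$, then $\lambda(S_{\mathcal G})=\nu$ and there exists an orthonormal basis $\{x_i\}_{i\in\mathbb I_d}$ of $\mathcal V$ such that $$S_{\mathcal F^\#_{\mathcal V}}=\sum_{i\in\mathbb I_d}\lambda^\#_{\mathcal V,i}\;x_i\otimes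 x_i\quad\text{and}\quad B=S_{\mathcal G}-S_{\mathcal F^\#_{\mathcal V}}=\sum_{i\in\mathbb I_d}\lambda_{d-i+1}(B)\;x_i\otimes x_i .$$
   Context: $\mathcal H$ is a complex separable Hilbert space; $\mathbb I_k=\{1,\dots,k\}$; $\mathbb M=\mathbb I_p$ if $\dim\mathcal H=p<\infty$ and $\mathbb M=\mathbb N$ if $\dim\mathcal H=\infty$. $\mathcal W^\perp\oplus\mathcal V=\mathcal H$ means $\mathcal W^\perp+\mathcal V=\mathcal H$ and $\mathcal W^\perp\cap\mathcal V=\{0\}$. $P_{\mathcal V//\mathcal W^\perp}$ is the oblique projection with range $\mathcal V$ and null space $\mathcal W^\perp$. $x\otimes x$ denotes the operator $f\mapsto\langle f,x\rangle x$. For a finite sequence $\mathcal F=\{f_i\}_{i\in\mathbb I_n}$ in $\mathcal H$: $T_{\mathcal F}:\mathbb C^n\to\mathcal H$, $T_{\mathcal F}(a)=\sum_i a_if_i$, and $S_{\mathcal F}=T_{\mathcal F}T_{\mathcal F}^*$ is the frame operator. A finite sequence in $\mathcal W$ is a frame for $\mathcal W$ iff it spans $\mathcal W$. $\mathcal D_{\mathcal V}(\mathcal F)$ is the set of oblique $\mathcal V$-duals of $\mathcal F$: sequences $\mathcal G=\{g_i\}_{i\in\mathbb I_n}$ in $\mathcal V$ such that $g=\sum_i\langle g,f_i\rangle g_i$ for all $g\in\mathcal V$, equivalently $T_{\mathcal G}T_{\mathcal F}^*=P_{\mathcal V//\mathcal W^\perp}$. The canonical $\mathcal V$-dual is $\mathcal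 F^\#_{\mathcal V}=\{P_{\mathcal V//\mathcal W^\perp}S_{\mathcal F}^\dagger f_i\}_{i\in\mathbb I_n}$ ($\dagger$ = Moore-Penrose pseudo-inverse). For $t\ge \operatorname{tr}(S_{\mathcal F^\#_{\mathcal V}})$, $\mathcal D_{\mathcal V,t}(\mathcal F)=\{\mathcal G=\{g_i\}_{i\in\mathbb I_n}\in\mathcal D_{\mathcal V}(\mathcal F):\sum_{i}\|g_i\|^2\ge t\}$. $\ell^1_+(\mathbb M)^\downarrow$ is the set of non-increasing, non-negative, summable sequences indexed by $\mathbb M$. For a finite sequence $\mathcal G$, $\lambda(S_{\mathcal G})\in\ell^1_+(\mathbb M)^\downarrow$ is the list of the positive eigenvalues of $S_{\mathcal G}$ (with multiplicity, non-increasing) followed by zeros. The operator $B$ above is positive semidefinite with range in $\mathcal V$, and $\lambda_1(B)\ge\dots\ge\lambda_d(B)$ are the eigenvalues of its restriction to $\mathcal V$, with multiplicity. $\mathrm{Conv}(\mathbb R_{\ge0})$ is the set of convex functions $h:[0,\infty)\to[0,\infty)$. For such $h$ and a finite sequence $\mathcal G$ in $\mathcal H$ whose span has dimension $r$, the convex potential is $P_h(\mathcal G)=\sum_{i=1}^r h(\lambda_i(S_{\mathcal G}))$; for $\mathcal G\in\mathcal D_{\mathcal V}(\mathcal F)$ the span is $\mathcal V$, so $r=d$.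
   Formalization: For t strictly greater than the trace of the canonical dual's frame operator, it is additionally assumed that 0 < d < n, since if n = d or d = 0 the set of oblique V-duals with sum of squared norms at least t is empty and item 1 fails. *)

(* Defs.v *)
From HB Require Import structures.
From mathcomp Require Import all_boot all_order all_algebra.
From mathcomp Require Import sesquilinear.
From mathcomp Require Import all_classical all_reals all_analysis.
From mathcomp Require Import complex.

Set Implicit Arguments.
Unset Strict Implicit.
Unset Printing Implicit Defensive.

Import Order.TTheory GRing.Theory Num.Theory Num.Def.
Import numFieldNormedType.Exports.

Local Open Scope classical_set_scope.
Local Open Scope ring_scope.
Local Open Scope complex_scope.
Local Open Scope convex_scope.
Local Open Scope card_scope.

Section LinearAlgebra.
Variables (R : realType) (H : completeNormedModType R[i]).

Definition synthesis_op n (F : 'I_n -> H) (a : 'rV[R[i]]_n) : H :=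
  \sum_(i < n) a 0 i *: F i.

Definition lin_span n (F : 'I_n -> H) : set H := range (synthesis_op F).

(* Equivalent, for finite sequences, to the two-sided frame inequality on A. *)
Definition frame_for n (F : 'I_n -> H) (A : set H) : Prop := lin_span F = A.

Definition lin_indep n (F : 'I_n -> H) : Prop := injective (synthesis_op F).

Definition basis_of_set n (F : 'I_n -> H) (A : set H) : Prop :=
  lin_indep F /\ lin_span F = A.

(* In particular such an A is a linear subspace. *)
Definition has_dim (A : set H) (k : nat) : Prop :=
  exists b : 'I_k -> H, basis_of_set b A.

(* Meaningful for finite-dimensional subspaces only; 0 by default. *)
Definition dim_of (A : set H) : nat := xget 0%N [set k | has_dim A k].

(* 0-based: i belongs to this set iff i.+1 <= dim H, so that it is {0..p-1} if
   dim H = p is finite, and all of nat otherwise. *)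
Definition index_set : set nat :=
  [set i | exists b : 'I_i.+1 -> H, lin_indep b].

Definition direct_sum_decomp (A B : set H) : Prop :=
  (forall x, exists a b, [/\ A a, B b & x = a + b]) /\ A `&` B = [set 0].

(* Sequences indexed by index_set are extended by 0 to all of nat. *)
Definition l1_dec : set (nat -> R) :=
  [set u : nat -> R |
    [/\ forall i, 0 <= u i,
        nonincreasing_seq u,
        cvgn (series u)
      & forall i, ~ index_set i -> u i = 0]].

(* u lists the positive eigenvalues of S with (geometric) multiplicity,
   non-increasingly, followed by zeros. *)
Definition is_eigenlist (S : H -> H) (u : nat -> R) : Prop :=
  l1_dec u /\
  forall c : R, 0 < c -> exists k : nat,
    has_dim [set x | S x = c%:C *: x] k /\ [set i | u i = c] #= `I_k.

Definition eigenlist (S : H -> H) : nat -> R :=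
  xget (fun=> 0) [set u | is_eigenlist S u].

(* mu lists the eigenvalues, zero included, of the restriction of S to V
   (dim V = d), with multiplicity and non-increasingly. *)
Definition is_eigenlist_on (S : H -> H) (V : set H) d (mu : {ffun 'I_d -> R}) :
  Prop :=
  (forall i j : 'I_d, (i <= j)%N -> mu j <= mu i) /\
  forall c : R, has_dim [set x | V x /\ S x = c%:C *: x] #|[set i | mu i == c]%SET|.

Definition eigenlist_on (S : H -> H) (V : set H) d : {ffun 'I_d -> R} :=
  xget [ffun=> 0] [set mu | is_eigenlist_on S V mu].

End LinearAlgebra.

Section ObliqueDuals.
Variables (R : realType) (H : completeNormedModType R[i]).
Variable dot : {dot H for (@conjC R[i])}.

Definition analysis_op n (F : 'I_n -> H) (f : H) : 'rV[R[i]]_n :=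
  \row_i dot f (F i).

(* analysis_op F is the adjoint of synthesis_op F. *)
Lemma analysis_adjoint n (F : 'I_n -> H) (a : 'rV[R[i]]_n) (f : H) :
  dot (synthesis_op F a) f = \sum_(i < n) a 0 i * conjC (analysis_op F f 0 i).
Proof.
rewrite /synthesis_op linear_sumlz; apply: eq_bigr => i _.
by rewrite linearZl_LR /= mxE [dot f _]hermC /= expr0 mul1r conjCK.
Qed.

Definition frame_op n (F : 'I_n -> H) (f : H) : H := synthesis_op F (analysis_op F f).

Definition rank1 (x f : H) : H := dot f x *: x.

Definition orthocompl (W : set H) : set H :=
  [set x | forall w, W w -> dot x w = 0].

(* Oblique projection with range V and null space N, where N + V = H and
   N, V intersect trivially. *)
Definition oblique_proj (V N : set H) (f : H) : H :=
  xget 0 [set v | V v /\ N (f - v)].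

Definition self_adjoint (S : H -> H) : Prop :=
  forall x y, dot (S x) y = dot x (S y).

(* The four Penrose equations; they determine X (is_pinv_unique). *)
Definition is_pinv (S X : H -> H) : Prop :=
  linear X /\
  [/\ forall f, S (X (S f)) = S f,
      forall f, X (S (X f)) = X f,
      self_adjoint (S \o X)
    & self_adjoint (X \o S)].

Lemma is_pinv_unique (S X Y : H -> H) : is_pinv S X -> is_pinv S Y -> X = Y.
Proof.
move=> [_ [SXS XSX SX XS]] [_ [SYS YSY SY YS]].
have nondeg (u v : H) : (forall w, dot u w = dot v w) -> u = v.
  move=> uv; apply/eqP; rewrite -subr_eq0 -(dnorm_eq0 dot).
  by rewrite linearBl /= uv subrr.
have E1 f : S (X f) = S (Y f).
  apply: nondeg => w; rewrite (SX f w) /= -[in LHS](SYS (X w)).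
  by rewrite -(SY f (S (X w))) /= -(SX (S (Y f)) w) /= SXS.
have E2 f : X (S f) = Y (S f).
  apply: nondeg => w; rewrite -[in LHS](SYS f) (XS (Y (S f)) w) /=.
  by rewrite (YS f (X (S w))) /= SXS -(YS f w).
by apply: funext => f; rewrite -(XSX f) E1 E2 YSY.
Qed.

Definition pinv (S : H -> H) : H -> H := xget (fun=> 0) [set X | is_pinv S X].

Definition oblique_dual (V : set H) n (F G : 'I_n -> H) : Prop :=
  (forall i, V (G i)) /\
  forall g, V g -> g = \sum_(i < n) dot g (F i) *: G i.

Definition oblique_dual_ge (V : set H) (t : R) n (F G : 'I_n -> H) : Prop :=
  oblique_dual V F G /\ t%:C <= \sum_(i < n) `|G i| ^+ 2.

Definition canonical_dual (V W : set H) n (F : 'I_n -> H) (i : 'I_n) : H :=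
  oblique_proj V (orthocompl W) (pinv (frame_op F) (F i)).

Definition orthonormal_basis d (x : 'I_d -> H) (V : set H) : Prop :=
  (forall i j, dot (x i) (x j) = (i == j)%:R) /\ lin_span x = V.

Definition convex_potential (h : R -> R) n (G : 'I_n -> H) : R :=
  \sum_(i < dim_of (lin_span G)) h (eigenlist (frame_op G) i).

End ObliqueDuals.

(* Functions on [0, +oo) are represented by functions on R; the values at
   negative arguments are irrelevant. *)
Section Convexity.
Variable R : realType.

Definition Conv (h : R -> R) : Prop :=
  (forall x, 0 <= x -> 0 <= h x) /\
  convex_function (`[0, +oo[%classic : set R) h.

Definition strictly_convex_nneg (h : R -> R) : Prop :=
  forall s x y : R, 0 < s < 1 -> 0 <= x -> 0 <= y -> x != y ->
    h (s * x + (1 - s) * y) < s * h x + (1 - s) * h y.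

Definition nondecreasing_nneg (h : R -> R) : Prop :=
  forall x y : R, 0 <= x -> x <= y -> h x <= h y.

End Convexity.

(* Main.v *)
(** Fix an orthonormal basis of V.  Duals of F become matrices G with Phi G = 1,
    where Phi is the matrix of cross inner products; if G0 is the matrix of the
    canonical dual then G^* G = A + Z^* Z with A = G0^* G0, Z = G - G0 and
    Phi Z = 0, so Z has rank at most m = n - d and is otherwise arbitrary.

    Let a_1 >= ... >= a_d be the eigenvalues of A.  By Weyl's inequalities the
    i-th eigenvalue of A + Z^* Z lies in the interval [a_i, a_(i-m)] (unbounded
    above when i <= m).  Let nu_i(c) be the point of this interval closest to c,
    where c is the water level for which the nu_i(c) sum up to t.  Then nu_i(c)
    lies between c and the i-th eigenvalue of any competitor, and convexity, in
    the form of a subgradient of h at c, gives the minimality of nu; no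
    majorization theory is needed.  As a multiset, nu consists of the d - m
    largest a_i and of max(a_i, c) for the others, hence it is attained.

    If a competitor has spectrum nu, one splits off one by one common
    eigenvectors of A and Z^* Z on which Z^* Z vanishes, until A + Z^* Z is the
    scalar c; this diagonalises both matrices simultaneously. *)

Require Import Defs.
From HB Require Import structures.
From mathcomp Require Import all_boot all_order all_algebra.
From mathcomp Require Import finmap fingroup perm.
From mathcomp Require Import sesquilinear spectral.
From mathcomp Require Import all_classical all_reals all_analysis.
From mathcomp Require Import complex.
From mathcomp Require Import zify ring lra.

Set Implicit Arguments.
Unset Strict Implicit.
Unset Printing Implicit Defensive.

Import Order.TTheory GRing.Theory Num.Theory Num.Def.
Import numFieldNormedType.Exports.

Local Open Scope classical_set_scope.
Local Open Scope ring_scope.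
Local Open Scope complex_scope.

(** * Hermitian matrices *)

Local Open Scope sesquilinear_scope.

Section Adjoint.
Variable C : numClosedFieldType.

Lemma adjmxM m n p (A : 'M[C]_(m, n)) (B : 'M[C]_(n, p)) :
  (A *m B)^t* = B^t* *m A^t*.
Proof. by rewrite trmx_mul map_mxM. Qed.

Lemma adjmxD m n (A B : 'M[C]_(m, n)) : (A + B)^t* = A^t* + B^t*.
Proof. by rewrite linearD map_mxD. Qed.

Lemma adjmxE m n (A : 'M[C]_(m, n)) i j : A^t* i j = conjC (A j i).
Proof. by rewrite !mxE. Qed.

Lemma mul_row_adj m n (v : 'rV[C]_n) (A : 'M[C]_(m, n)) i :
  (v *m (row i A)^t*) 0 0 = (v *m A^t*) 0 i.
Proof. by rewrite !mxE; apply: eq_bigr => k _; rewrite !adjmxE mxE. Qed.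

Lemma adjmx1 n : (1%:M : 'M[C]_n)^t* = 1%:M.
Proof. by rewrite trmx1 map_mx1. Qed.

Lemma rank_adjmx m n (A : 'M[C]_(m, n)) : \rank (A^t*) = \rank A.
Proof. by rewrite mxrank_map mxrank_tr. Qed.

Lemma unitarymxCP n (U : 'M[C]_n) : U \is unitarymx -> U^t* *m U = 1%:M.
Proof.
by move=> Uu; rewrite -invmx_unitary // mulVmx // unitarymx_unit.
Qed.

Lemma char_poly_conj n (U A : 'M[C]_n) : U \is unitarymx ->
  char_poly (U^t* *m A *m U) = char_poly A.
Proof.
move=> Uu; have UV := unitarymxCP Uu.
pose P := map_mx polyC U; pose Q := map_mx polyC (U^t*).
have QP : Q *m P = 1%:M by rewrite -map_mxM UV map_mx1.
rewrite /char_poly.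
have -> : char_poly_mx (U^t* *m A *m U) = Q *m char_poly_mx A *m P.
  rewrite /char_poly_mx !map_mxM mulmxBr mulmxBl; congr (_ - _).
  by rewrite scalar_mxC -mulmxA QP mulmx1.
rewrite !det_mulmx mulrC mulrA -det_mulmx.
by rewrite (_ : P *m Q = 1%:M) ?det1 ?mul1r //; apply: mulmx1C.
Qed.

(** Vectors are rows and matrices act on the right, so the eigenvectors of [U^t* *m D *m U] with [D]
    diagonal are the rows of the unitary [U]. *)
Definition qform n (A : 'M[C]_n) (v : 'rV_n) : C := (v *m A *m v^t*) 0 0.

Lemma qformD n (A B : 'M[C]_n) v : qform (A + B) v = qform A v + qform B v.
Proof. by rewrite /qform mulmxDr mulmxDl mxE. Qed.

Lemma qform0 n (A : 'M[C]_n) : qform A 0 = 0.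
Proof. by rewrite /qform !mul0mx mxE. Qed.

Lemma qform1E n (v : 'rV[C]_n) : qform 1%:M v = \sum_i `|v 0 i| ^+ 2.
Proof.
rewrite /qform mulmx1 mxE; apply: eq_bigr => i _.
by rewrite adjmxE normCK.
Qed.

Lemma qform1_ge0 n (v : 'rV[C]_n) : 0 <= qform 1%:M v.
Proof. by rewrite qform1E; apply: sumr_ge0 => i _; rewrite exprn_ge0. Qed.

Lemma qform1_eq0 n (v : 'rV[C]_n) : (qform 1%:M v == 0) = (v == 0).
Proof.
apply/idP/eqP=> [|->]; last by rewrite qform0.
rewrite qform1E psumr_eq0 => [|i _]; last by rewrite exprn_ge0.
move=> /allP h; apply/rowP => i; rewrite mxE.
by have := h i (mem_index_enum _); rewrite sqrf_eq0 normr_eq0 => /eqP.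
Qed.

Lemma qform1_gt0 n (v : 'rV[C]_n) : v != 0 -> 0 < qform 1%:M v.
Proof. by rewrite -qform1_eq0 lt_neqAle qform1_ge0 andbT eq_sym. Qed.

Lemma qform_gram n k (Z : 'M[C]_(k, n)) v :
  qform (Z^t* *m Z) v = qform 1%:M (v *m Z^t*).
Proof. by rewrite /qform mulmx1 adjmxM trmxCK !mulmxA. Qed.

(** Gram-Schmidt on a row basis. For rectangular matrices [unitarymx] means orthonormal rows. *)
Lemma unitary_basis m n r (W : 'M[C]_(m, n)) : \rank W = r ->
  exists2 K : 'M[C]_(r, n), K \is unitarymx & (K <= W)%MS.
Proof.
move=> <-; exists (schmidt (row_base W)).
  by rewrite schmidt_unitarymx // rank_leq_col.
by rewrite eqmx_schmidt_free ?eq_row_base // row_base_free.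
Qed.

Lemma unitary_first_row n (v : 'rV[C]_n.+1) : v \is unitarymx ->
  exists K : 'M[C]_(n, n.+1), (col_mx v K : 'M[C]_(1 + n)) \is unitarymx.
Proof.
move=> vu.
have rk : \rank (orthomx conjC (mx_of_hermitian (hermitian1mx _)) v) = n.
  by rewrite rank_ortho mxrank_unitary // subn1.
set W := orthomx _ _ _ in rk.
have [K Ku KW] := unitary_basis rk.
exists K; apply/unitarymxP; rewrite tr_col_mx map_row_mx mul_col_row.
have Kv : K *m v^t* = 0 by apply/orthomx1P.
have vK : v *m K^t* = 0.
  by rewrite -[v]trmxCK -adjmxM Kv trmx0 map_mx0.
by rewrite Kv vK (unitarymxP vu) (unitarymxP Ku) scalar_mx_block.
Qed.

(** The rows of [K] are an orthonormal basis of the orthogonal complement of the row space of [Phi].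
    Perturbations of a dual are later built from them. *)
Lemma unitary_kernel d n (Phi : 'M[C]_(d, n)) : \rank Phi = d ->
  exists2 K : 'M[C]_(n - d, n), K \is unitarymx & Phi *m K^t* = 0.
Proof.
move=> rkP.
pose W := orthomx conjC (mx_of_hermitian (hermitian1mx _)) Phi.
have rk : \rank W = (n - d)%N by rewrite rank_ortho rkP.
have [K Ku KW] := unitary_basis rk; exists K => //.
rewrite -[Phi]trmxCK -adjmxM.
by have /orthomx1P -> : (K <= W)%MS by []; rewrite trmx0 map_mx0.
Qed.

Lemma exists_kernel_vector d p (K : 'M[C]_(d, p)) : (\rank K < d)%N ->
  exists2 v : 'rV_d, v != 0 & v *m K = 0.
Proof.
move=> rk.
have : kermx K != 0 by rewrite -mxrank_eq0 mxrank_ker subn_eq0 -ltnNge.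
by move=> /rowV0Pn [v /sub_kermxP vK v0]; exists v.
Qed.

Lemma hermitian_diag n (M : 'M[C]_n) : M^t* = M ->
  exists U : 'M[C]_n, exists2 s : 'rV_n, U \is unitarymx &
    (forall i, s 0 i \is Num.real) /\ M = U^t* *m diag_mx s *m U.
Proof.
move=> Mh.
have hM : M \is hermsymmx by apply/is_hermitianmxP; rewrite expr0 scale1r Mh.
have /orthomx_spectralP eM := hermitian_normalmx hM.
have /mxOverP rM := hermitian_spectral_diag_real hM.
exists (spectralmx M), (spectral_diag M); first exact: spectral_unitarymx.
by split=> //; rewrite -invmx_unitary ?spectral_unitarymx.
Qed.

(** Matrix form of the canonical dual: [Psi] will hold the coordinates of the frame in W, [invmx M]
    is the pseudo-inverse of the frame operator, and [invmx E] is the oblique projection. The second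
    identity puts [G] in the range of the adjoint of [E *m Psi^t*], which yields its orthogonality
    to differences of duals. *)
Lemma pinv_dual_matrix n d (Psi : 'M[C]_(n, d)) (E : 'M[C]_d)
    (M := Psi^t* *m Psi) (G := Psi *m invmx M *m invmx E) :
  E \in unitmx -> M \in unitmx ->
  (E *m Psi^t*) *m G = 1%:M /\
  G = (E *m Psi^t*)^t* *m (invmx (E^t*) *m invmx M *m invmx E).
Proof.
move=> Eu Mu; have Eu' : E^t* \in unitmx by rewrite map_unitmx unitmx_tr.
split; rewrite /G.
  rewrite !mulmxA -[E *m _ *m Psi]mulmxA -/M.
  by rewrite -[E *m M *m _]mulmxA mulmxV // mulmx1 mulmxV.
by rewrite adjmxM trmxCK !mulmxA -[Psi *m E^t* *m _]mulmxA mulmxV // mulmx1.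
Qed.

End Adjoint.

(** * Spectra of Hermitian matrices as real lists *)

Section Spectrum.
Variable R : rcfType.
Local Notation C := R[i].

Definition rdiag d (l : seq R) : 'M[C]_d := diag_mx (\row_i (nth 0 l i)%:C).

(** Encoding by the factored characteristic polynomial determines [l] up to permutation, by unique
    factorisation; sortedness is a separate hypothesis where it matters. *)
Definition spec d (M : 'M[C]_d) (l : seq R) :=
  M^t* = M /\ char_poly M = \prod_(z <- l) ('X - (z%:C)%:P).

Lemma conjC_real (x : R) : conjC (x%:C : C) = x%:C.
Proof. by apply/CrealP/complex_realP; exists x. Qed.

Lemma spec_herm d (M : 'M[C]_d) l : spec M l -> M^t* = M.
Proof. by case. Qed.

Lemma spec_size d (M : 'M[C]_d) l : spec M l -> size l = d.
Proof.
move=> [_ /(congr1 (size : {poly C} -> nat))].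
by rewrite size_char_poly size_prod_XsubC => -[].
Qed.

Lemma spec_perm d (M : 'M[C]_d) l l' : perm_eq l l' -> spec M l -> spec M l'.
Proof. by move=> ll' [h e]; split=> //; rewrite e; apply: perm_big. Qed.

Lemma prod_XsubC_perm (l l' : seq R) :
  \prod_(z <- l) ('X - (z%:C : C)%:P) = \prod_(z <- l') ('X - (z%:C)%:P) ->
  perm_eq l l'.
Proof.
move=> e; apply: (perm_map_inj (@complexI R)).
by apply: prod_XsubC_eq; rewrite !big_map e.
Qed.

Lemma spec_uniq d (M : 'M[C]_d) l l' : spec M l -> spec M l' -> perm_eq l l'.
Proof. by move=> [_ e] [_ e']; apply: prod_XsubC_perm; rewrite -e. Qed.

Lemma rdiag_adj d l : (rdiag d l)^t* = rdiag d l.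
Proof.
rewrite /rdiag tr_diag_mx map_diag_mx; congr diag_mx.
apply/rowP=> i; rewrite !mxE. exact: conjC_real.
Qed.

Lemma diag_spec d (U : 'M[C]_d) l : size l = d -> U \is unitarymx ->
  spec (U^t* *m rdiag d l *m U) l.
Proof.
move=> sl Uu; split; first by rewrite !adjmxM trmxCK rdiag_adj mulmxA.
rewrite char_poly_conj // char_poly_trig ?diag_mx_is_trig //.
rewrite (big_nth 0) sl big_mkord; apply: eq_bigr => i _.
by rewrite !mxE eqxx mulr1n.
Qed.

Lemma spec_exists d (M : 'M[C]_d) : M^t* = M ->
  exists U : 'M[C]_d, exists2 l : seq R,
    U \is unitarymx & size l = d /\ M = U^t* *m rdiag d l *m U.
Proof.
move=> /hermitian_diag[U [s Uu [rs eM]]].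
(* The entries of [s] are real, so taking real parts loses nothing. *)
pose z i := if insub i is Some j then complex.Re (s 0 j) else 0.
have es : diag_mx s = rdiag d (mkseq z d).
  congr diag_mx; apply/rowP => i.
  by rewrite mxE nth_mkseq // /z valK RRe_real.
by exists U, (mkseq z d); [exact: Uu|rewrite size_mkseq -es].
Qed.

(** Every ordering of the eigenvalues is realised: permuting the rows of a diagonalising [U]
    permutes the diagonal. *)
Lemma spec_diag d (M : 'M[C]_d) l : spec M l ->
  exists2 U : 'M[C]_d, U \is unitarymx & M = U^t* *m rdiag d l *m U.
Proof.
move=> sM; have sl := spec_size sM.
have [U [l' Uu [sl' eM]]] := spec_exists (spec_herm sM).
have pl : perm_eq l l' by apply: (spec_uniq sM); rewrite eM; apply: diag_spec.
have /perm_iotaP pi : perm_eq l l' by [].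
have [t [pt el]] : exists t,
    perm_eq t (iota 0 d) /\ l = [seq nth 0 l' i | i <- t].
  by have [t pt el] := pi 0; exists t; split; rewrite // -sl'.
have st : size t = d by rewrite (perm_size pt) size_iota.
have tP (i : 'I_d) : (nth 0%N t i < d)%N.
  have it : (i < size t)%N by rewrite st.
  by have := mem_nth 0%N it; rewrite (perm_mem pt) mem_iota.
pose s (i : 'I_d) := Ordinal (tP i).
have s_inj : injective s.
  move=> i j [/eqP]; rewrite nth_uniq ?st // => [/eqP/val_inj //|].
  by rewrite (perm_uniq pt) iota_uniq.
pose U' := row_perm (perm s_inj) U.
exists U'; first by apply/unitarymxP; rewrite /U' row_permE adjmxM mulmxA
  -[_ *m U *m _]mulmxA (unitarymxP Uu) mulmx1 tr_perm_mx map_perm_mx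
  -perm_mxM mulgV perm_mx1.
rewrite eM; apply/matrixP => i j; rewrite !mxE.
rewrite (reindex_inj (@perm_inj _ (perm s_inj))); apply: eq_bigr => k _ /=.
rewrite !mxE; congr (_ * _).
rewrite (reindex_inj (@perm_inj _ (perm s_inj))); apply: eq_bigr => q _ /=.
rewrite !mxE (inj_eq perm_inj) !permE /= [in RHS]el.
by rewrite (nth_map 0%N) ?st.
Qed.

Lemma sort_spec_exists d (M : 'M[C]_d) : M^t* = M ->
  exists2 l : seq R, spec M l & sorted >=%R l.
Proof.
move=> Mh; have [U [l Uu [sl eM]]] := spec_exists Mh.
exists (sort >=%R l); last by apply: sort_sorted => x y; apply: le_total.
apply: (@spec_perm _ _ l); first by rewrite perm_sym perm_sort.
by rewrite eM; apply: diag_spec.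
Qed.

Lemma spec_trace d (M : 'M[C]_d) l : spec M l -> \tr M = (\sum_(z <- l) z)%:C.
Proof.
move=> sM; have sl := spec_size sM; have [U Uu ->] := spec_diag sM.
rewrite mxtrace_mulC mulmxA (unitarymxP Uu) mul1mx mxtrace_diag.
rewrite (big_nth 0) sl big_mkord rmorph_sum; apply: eq_bigr => i _.
by rewrite !mxE.
Qed.

Lemma qform_diag d (U : 'M[C]_d) l v :
  qform (U^t* *m rdiag d l *m U) v =
  \sum_(i < d) (nth 0 l i)%:C * `|(v *m U^t*) 0 i| ^+ 2.
Proof.
rewrite /qform; have -> : v *m (U^t* *m rdiag d l *m U) *m v^t* =
    (v *m U^t*) *m rdiag d l *m (v *m U^t*)^t*.
  by rewrite adjmxM trmxCK !mulmxA.
rewrite mul_mx_diag mxE; apply: eq_bigr => i _.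
rewrite [X in X * _]mxE adjmxE normCK [X in _ * X * _]mxE.
by rewrite mulrAC mulrC.
Qed.

Lemma qform1_unitary d (U : 'M[C]_d) v : U \is unitarymx ->
  qform 1%:M v = \sum_i `|(v *m U^t*) 0 i| ^+ 2.
Proof.
by move=> Uu; rewrite -qform1E /qform !mulmx1 adjmxM trmxCK mulmxA
  -[v *m _ *m _]mulmxA unitarymxCP // mulmx1.
Qed.

(** A Rayleigh quotient bound. It is asked only at the indices where [v] has a nonzero coordinate,
    so it applies to vectors of a spectral subspace. *)
Lemma qform_le d (U : 'M[C]_d) l v (x : R) : U \is unitarymx ->
  (forall i, (v *m U^t*) 0 i != 0 -> nth 0 l i <= x) ->
  qform (U^t* *m rdiag d l *m U) v <= x%:C * qform 1%:M v.
Proof.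
move=> Uu h; rewrite qform_diag (qform1_unitary v Uu) mulr_sumr.
apply: ler_sum => i _.
have [->|/h hi] := eqVneq ((v *m U^t*) 0 i) 0.
  by rewrite normr0 expr0n /= !mulr0.
by rewrite ler_wpM2r ?exprn_ge0 // lecR.
Qed.

Lemma qform_ge d (U : 'M[C]_d) l v (x : R) : U \is unitarymx ->
  (forall i, (v *m U^t*) 0 i != 0 -> x <= nth 0 l i) ->
  x%:C * qform 1%:M v <= qform (U^t* *m rdiag d l *m U) v.
Proof.
move=> Uu h; rewrite qform_diag (qform1_unitary v Uu) mulr_sumr.
apply: ler_sum => i _.
have [->|/h hi] := eqVneq ((v *m U^t*) 0 i) 0.
  by rewrite normr0 expr0n /= !mulr0.
by rewrite ler_wpM2r ?exprn_ge0 // lecR.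
Qed.

(** Equality forces each nonnegative gap, [x - l_i] times the squared modulus of the i-th
    coordinate, to vanish; hence [v] is supported on the eigenspace of [x]. *)
Lemma qform_max_eigen d (U : 'M[C]_d) l v (x : R) : U \is unitarymx ->
  (forall i, (v *m U^t*) 0 i != 0 -> nth 0 l i <= x) ->
  qform (U^t* *m rdiag d l *m U) v = x%:C * qform 1%:M v ->
  v *m (U^t* *m rdiag d l *m U) = x%:C *: v.
Proof.
move=> Uu h; rewrite qform_diag (qform1_unitary v Uu) mulr_sumr => e.
have e0 (i : 'I_d) : (nth 0 l i)%:C * `|(v *m U^t*) 0 i| ^+ 2 =
            x%:C * `|(v *m U^t*) 0 i| ^+ 2.
  apply/eqP; rewrite eq_sym -subr_eq0; apply/eqP.
  pose g (i : 'I_d) : C := x%:C * `|(v *m U^t*) 0 i| ^+ 2 -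
                           (nth 0 l i)%:C * `|(v *m U^t*) 0 i| ^+ 2.
  apply: (@psumr_eq0P _ _ predT g) => // [j _|]; last first.
    by rewrite /g sumrB e subrr.
  rewrite /g; have [->|/h hj] := eqVneq ((v *m U^t*) 0 j) 0.
    by rewrite normr0 expr0n /= !mulr0 subrr.
  by rewrite -mulrBl mulr_ge0 ?exprn_ge0 // subr_ge0 lecR.
suff -> : v *m (U^t* *m rdiag d l *m U) = (x%:C *: (v *m U^t*)) *m U.
  by rewrite -scalemxAl -mulmxA unitarymxCP // mulmx1.
rewrite !mulmxA; congr (_ *m _); apply/rowP => i.
rewrite mul_mx_diag mxE [RHS]mxE [X in _ * X = _]mxE.
have [->|n0] := eqVneq ((v *m U^t*) 0 i) 0; first by rewrite mul0r mulr0.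
have /mulIf -> := e0 i; first by rewrite mulrC.
by rewrite expf_neq0 // normr_eq0.
Qed.

End Spectrum.

(** * Water filling and spectral inequalities *)

Section WaterFilling.
Variable R : realDomainType.
Implicit Types (a : seq R) (c : R) (m : nat).

(* For a nonincreasing [a], the [m] smallest entries are raised to the level [c]
   and the others are left alone; [pad] lists the increments. *)
Fixpoint fill c m a : seq R :=
  if a is x :: a' then
    (if (m <= size a')%N then x else Num.max x c) :: fill c m a'
  else [::].

Fixpoint pad c m a : seq R :=
  if a is x :: a' then
    (if (m <= size a')%N then 0 else Num.max x c - x) :: pad c m a'
  else [::].

(* [c] clipped to the interval from [a_i] to [a_(i-m)]. *)
Definition clamp c m a i : R :=
  Num.max (nth 0 a i) (if (i < m)%N then c else Num.min c (nth 0 a (i - m))).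

Lemma sorted_ge_nth a i j : sorted >=%R a -> (i <= j < size a)%N ->
  nth 0 a j <= nth 0 a i.
Proof.
move=> sa /andP[ij ja]; have ge_tr : transitive (>=%R : rel R).
  by move=> y x z xy yz; apply: le_trans yz xy.
by apply: (sorted_leq_nth ge_tr lexx 0 sa) => //; apply: leq_ltn_trans ja.
Qed.

Lemma size_fill c m a : size (fill c m a) = size a.
Proof. by elim: a => //= x a ->. Qed.

Lemma size_pad c m a : size (pad c m a) = size a.
Proof. by elim: a => //= x a ->. Qed.

Lemma nth_pad c m a i : nth 0 (pad c m a) i = nth 0 (fill c m a) i - nth 0 a i.
Proof.
elim: a i => [|x a IH] [|i] //=; rewrite ?nth_nil ?subr0 //.
by case: ifP; rewrite ?subrr.
Qed.

Lemma pad_ge0 c m a i : 0 <= nth 0 (pad c m a) i.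
Proof.
elim: a i => [|x a IH] [|i] //=; rewrite ?nth_nil //.
by case: ifP; rewrite // subr_ge0 le_max lexx.
Qed.

Lemma pad_eq0 c m a i : (i < size a - m)%N -> nth 0 (pad c m a) i = 0.
Proof.
elim: a i => [|x a IH] [|i] //=; first by case: ifP => //; lia.
by move=> h; apply: IH; lia.
Qed.

(** The increment of a raised entry [x] is the positive part of [c - x], which grows as [x]
    decreases. This is the source of the opposite orderings of the two spectra in the equality
    case. *)
Lemma pad_nondecreasing c m a i j : sorted >=%R a -> (i <= j < size a)%N ->
  nth 0 (pad c m a) i <= nth 0 (pad c m a) j.
Proof.
elim: a i j => [|x a IH] [|i] [|j] //= sa ij; last first.
  by apply: IH; rewrite ?(path_sorted sa).
have ja : (j < size a)%N by [].
case: (leqP m (size a)) => ma; first exact: pad_ge0.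
have := IH 0%N j (path_sorted sa); rewrite ja => /(_ isT).
case: a sa ja ma {IH ij} => //= y a /andP[xy sa] ja ma; apply: le_trans.
rewrite ifF; last by lia.
case: (leP x c) => xc; last by rewrite subrr subr_ge0 le_max lexx.
by rewrite (max_idPr (le_trans xy xc)) lerD2l lerN2.
Qed.

Lemma fill_le c m a x : c <= x -> all (<= x) a -> all (<= x) (fill c m a).
Proof.
move=> cx; elim: a => //= y a IH /andP[yx /IH ->]; rewrite andbT.
by case: ifP; rewrite // ge_max yx cx.
Qed.

Lemma fill_above c m a : all (<= c) a ->
  fill c m a = take (size a - m) a ++ nseq (minn m (size a)) c.
Proof.
elim: a => [|x a IH]; first by rewrite minn0.
rewrite [all _ _]/= [fill _ _ _]/= [size _]/= => /andP[xc /IH ->].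
case: leqP => ma.
  by rewrite subSn // (minn_idPl (leqW ma)).
have -> : (size a - m = 0)%N by lia.
have -> : ((size a).+1 - m = 0)%N by lia.
by rewrite !take0 (max_idPr xc) (minn_idPr ma).
Qed.

Lemma path_ge_all (x : R) a : path >=%R x a -> all (<= x) a.
Proof.
move=> /order_path_min h; apply: h => y z t zy tz.
by apply: le_trans tz zy.
Qed.

(** Induction on [a]. A head at least [c] is kept by both lists, and the remaining clamps are those
    of the tail. Once all entries are below [c], the clamps are copies of [c] followed by the
    largest entries, and [fill] consists of the same two blocks swapped. *)
Lemma clamp_perm c m a : sorted >=%R a ->
  perm_eq (mkseq (clamp c m a) (size a)) (fill c m a).
Proof.
elim: a => [//|x a IH] sa.
have [cx|xc] := leP c x.
  rewrite /= -cat1s -[X in perm_eq _ X]cat1s -add1n /mkseq iotaD map_cat.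
  apply: perm_cat.
    rewrite /= /clamp /= ?sub0n /=; case: ifP => _; case: ifP => _;
      by rewrite ?(min_idPl cx) (max_idPl cx).
  apply: perm_trans (IH (path_sorted sa)); rewrite add0n (iotaDl 1) -map_comp.
  apply/seq.permP => p; congr (count p _); apply: eq_map => i /=.
  rewrite /clamp /= add1n /=; congr Num.max.
  case: (ltngtP i.+1 m) => [h|h|h].
  - by [].
  - by rewrite subSn.
  (* At index [m] the upper end of the interval is the head [x], which is at least [c] and so does
     not bind. *)
  - by rewrite h subnn /= (min_idPl cx).
have ax : all (<= x) (x :: a) by rewrite /= lexx path_ge_all.
have ac : all (<= c) (x :: a).
  by apply: sub_all ax => y yx; apply: le_trans yx (ltW xc).
move: (x :: a) sa ac => {IH xc x ax} {}a sa ac.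
rewrite fill_above // perm_sym perm_catC.
suff -> : mkseq (clamp c m a) (size a) =
    nseq (minn m (size a)) c ++ take (size a - m) a by [].
apply: (@eq_from_nth _ 0).
  by rewrite size_cat size_nseq size_mkseq size_takel ?leq_subr //; lia.
move=> i; rewrite size_mkseq => ia.
rewrite nth_mkseq // nth_cat size_nseq nth_nseq /clamp.
have aic j : (j < size a)%N -> nth 0 a j <= c.
  by move=> ja; move/allP: ac; apply; apply: mem_nth.
case: ltnP => im.
  by rewrite leq_min im ia (max_idPr (aic _ ia)).
rewrite ifF; last by lia.
have -> : minn m (size a) = m by lia.
rewrite nth_take; last by lia.
rewrite (min_idPr _) ?(max_idPr _) //; last by apply: aic; lia.
by apply: sorted_ge_nth => //; lia.
Qed.

Lemma clamp_nonincreasing c m a i j : sorted >=%R a -> (i <= j < size a)%N ->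
  clamp c m a j <= clamp c m a i.
Proof.
move=> sa ij; rewrite /clamp; apply: le_max2; first exact: sorted_ge_nth.
case: (ltnP j m) => jm; first by rewrite (leq_ltn_trans _ jm) //; lia.
case: ltnP => im; first by rewrite ge_min lexx.
by apply: le_min2 => //; apply: sorted_ge_nth => //; lia.
Qed.

(** The point of an interval closest to [c] lies between [c] and any other point of it; [x] will be
    an eigenvalue of a competitor. *)
Lemma clamp_between c m a i (x : R) : nth 0 a i <= x ->
  ((m <= i)%N -> x <= nth 0 a (i - m)) ->
  (c <= clamp c m a i <= x) || (x <= clamp c m a i <= c).
Proof.
rewrite /clamp; set lo := nth 0 a i; set hi := nth 0 a (i - m) => lox xhi.
have between_c : (c <= Num.max lo c <= x) || (x <= Num.max lo c <= c).
  have [_|/ltW cl] := leP lo c; last by rewrite cl lox.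
  by rewrite lexx andbT; exact: le_total.
case: (ltnP i m) => // /xhi {}xhi.
have [//|/ltW hc] := leP c hi.
by rewrite (max_idPr (le_trans lox xhi)) xhi hc orbT.
Qed.

End WaterFilling.

(** * Weyl's inequalities for positive semidefinite perturbations of bounded rank *)

Section Weyl.
Variable R : rcfType.
Local Notation C := R[i].

Lemma pid_mxE n (v : 'rV[C]_n) r j : (v *m pid_mx r) 0 j = v 0 j *+ (j < r)%N.
Proof.
rewrite mxE (bigD1 j) //= big1 ?addr0 => [|k kj].
  by rewrite mxE eqxx /= mulr_natr.
by rewrite mxE (inj_eq val_inj) (negPf kj) mulr0.
Qed.

Lemma copid_mxE n (v : 'rV[C]_n) r j :
  (v *m copid_mx r) 0 j = v 0 j *+ (r <= j)%N.
Proof.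
rewrite /copid_mx mulmxBr mulmx1 mxE [X in _ + X]mxE pid_mxE.
by case: ltnP; rewrite ?subrr ?subr0.
Qed.

Lemma rank_row_mx m n1 n2 (A : 'M[C]_(m, n1)) (B : 'M[C]_(m, n2)) :
  (\rank (row_mx A B) <= \rank A + \rank B)%N.
Proof.
rewrite -mxrank_tr tr_row_mx -addsmxE -[\rank A]mxrank_tr -[\rank B]mxrank_tr.
exact: mxrank_adds_leqif.
Qed.

Lemma mul_row_mx_eq0 m n1 n2 (A : 'M[C]_(m, n1)) (B : 'M[C]_(m, n2)) (v : 'rV_m) :
  v *m row_mx A B = 0 -> v *m A = 0 /\ v *m B = 0.
Proof. by rewrite mul_mx_row => /eqP; rewrite row_mx_eq0 => /andP[/eqP ? /eqP]. Qed.

(** Lying in the span of the first [r] rows of [U] becomes a linear equation, so several such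
    conditions combine in one [row_mx] and are counted by rank. *)
Lemma mul_copid_eq0 n (v : 'rV[C]_n) (U : 'M[C]_n) r i :
  v *m (U^t* *m copid_mx r) = 0 -> (v *m U^t*) 0 i != 0 -> (i < r)%N.
Proof.
rewrite mulmxA => /matrixP/(_ 0 i); rewrite copid_mxE [RHS]mxE.
by case: ltnP => //= _; rewrite mulr1n => ->; rewrite eqxx.
Qed.

Lemma mul_pid_eq0 n (v : 'rV[C]_n) (U : 'M[C]_n) r i :
  v *m (U^t* *m (pid_mx r : 'M[C]_n)) = 0 -> (v *m U^t*) 0 i != 0 -> (r <= i)%N.
Proof.
rewrite mulmxA => /matrixP/(_ 0 i); rewrite pid_mxE [RHS]mxE.
by case: ltnP => //= _; rewrite mulr1n => ->; rewrite eqxx.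
Qed.

Lemma rank_mul_copid n (U : 'M[C]_n) r : (r <= n)%N ->
  (\rank (U *m copid_mx r) <= n - r)%N.
Proof. by move=> rn; rewrite (leq_trans (mxrankM_maxr _ _)) // rank_copid_mx. Qed.

Lemma rank_mul_pid n (U : 'M[C]_n) r : (r <= n)%N ->
  (\rank (U *m (pid_mx r : 'M[C]_n)) <= r)%N.
Proof. by move=> rn; rewrite (leq_trans (mxrankM_maxr _ _)) // rank_pid_mx. Qed.

(** The first [i + 1] eigenvectors of [A] and the eigenvectors of the sum of index at least [i] span
    spaces with a common nonzero vector: together they impose at most [d - 1] conditions. The two
    quadratic forms are compared on it. *)
Lemma weyl_monotone d p (A : 'M[C]_d) (Z : 'M[C]_(p, d)) a x i :
  spec A a -> sorted >=%R a -> spec (A + Z^t* *m Z) x -> sorted >=%R x ->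
  (i < d)%N -> nth 0 a i <= nth 0 x i.
Proof.
move=> sA ssa sX ssx id; have za := spec_size sA; have zx := spec_size sX.
have [U Uu eA] := spec_diag sA; have [U' Uu' eX] := spec_diag sX.
have [|v v0 /mul_row_mx_eq0[vU vU']] := @exists_kernel_vector _ _ _
  (row_mx (U^t* *m copid_mx i.+1) (U'^t* *m (pid_mx i : 'M[C]_d))).
  apply: leq_ltn_trans (rank_row_mx _ _) _.
  apply: leq_ltn_trans
    (leq_add (rank_mul_copid _ id) (rank_mul_pid _ (ltnW id))) _; lia.
have h1 : (nth 0 a i)%:C * qform 1%:M v <= qform A v.
  rewrite eA; apply: (qform_ge Uu) => j /(mul_copid_eq0 vU) ji.
  by apply: sorted_ge_nth; rewrite // za id andbT -ltnS.
have h2 : qform (A + Z^t* *m Z) v <= (nth 0 x i)%:C * qform 1%:M v.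
  rewrite eX; apply: (qform_le Uu') => j /(mul_pid_eq0 vU') ij.
  by apply: sorted_ge_nth => //; rewrite zx ij ltn_ord.
rewrite -lecR -(ler_pM2r (qform1_gt0 v0)); apply: le_trans h1 (le_trans _ h2).
by rewrite qformD lerDl qform_gram qform1_ge0.
Qed.

(** The same count with the kernel of [Z] included: at most [m + (d - i - 1) + (i - m) = d - 1]
    conditions, and the perturbation vanishes on the resulting vector. *)
Lemma weyl_rank d p (A : 'M[C]_d) (Z : 'M[C]_(p, d)) a x m i :
  spec A a -> sorted >=%R a -> spec (A + Z^t* *m Z) x -> sorted >=%R x ->
  (\rank Z <= m)%N -> (m <= i < d)%N -> nth 0 x i <= nth 0 a (i - m).
Proof.
move=> sA ssa sX ssx rZ /andP[mi id].
have za := spec_size sA; have zx := spec_size sX.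
have [U Uu eA] := spec_diag sA; have [U' Uu' eX] := spec_diag sX.
have [|v v0 /mul_row_mx_eq0[vZ /mul_row_mx_eq0[vU' vU]]] :=
  @exists_kernel_vector _ _ _ (row_mx (Z^t*)
    (row_mx (U'^t* *m copid_mx i.+1) (U^t* *m (pid_mx (i - m) : 'M[C]_d)))).
  apply: leq_ltn_trans (rank_row_mx _ _) _; rewrite rank_adjmx.
  have imd : (i - m <= d)%N by lia.
  apply: leq_ltn_trans (leq_add rZ (leq_trans (rank_row_mx _ _)
    (leq_add (rank_mul_copid _ id) (rank_mul_pid _ imd)))) _; lia.
have h1 : (nth 0 x i)%:C * qform 1%:M v <= qform (A + Z^t* *m Z) v.
  rewrite eX; apply: (qform_ge Uu') => j /(mul_copid_eq0 vU') ji.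
  by apply: sorted_ge_nth; rewrite // zx id andbT -ltnS.
have h2 : qform A v <= (nth 0 a (i - m))%:C * qform 1%:M v.
  rewrite eA; apply: (qform_le Uu) => j /(mul_pid_eq0 vU) ij.
  by apply: sorted_ge_nth => //; rewrite za ij ltn_ord.
rewrite -lecR -(ler_pM2r (qform1_gt0 v0)); apply: le_trans h1 (le_trans _ h2).
by rewrite qformD qform_gram vZ qform0 addr0.
Qed.

End Weyl.

(** * Splitting off a common eigenvector *)

Section Deflation.
Variable C : numClosedFieldType.

Lemma char_poly_deflate d (x : C) (M : 'M[C]_d) :
  char_poly (block_mx x%:M 0 0 M : 'M[C]_(1 + d)) = ('X - x%:P) * char_poly M.
Proof.
rewrite /char_poly /char_poly_mx (map_block_mx polyC) !map_mx0 scalar_mx_block.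
rewrite opp_block_mx add_block_mx !oppr0 !addr0 det_ublock; congr (_ * _).
by rewrite det_mx11 !mxE eqxx !mulr1n.
Qed.

Lemma unitary_block1 d (U : 'M[C]_d) : U \is unitarymx ->
  (block_mx 1%:M 0 0 U : 'M[C]_(1 + d)) \is unitarymx.
Proof.
move=> Uu; apply/unitarymxP.
rewrite tr_block_mx map_block_mx mulmx_block adjmx1 !trmx0 !map_mx0.
by rewrite !mulmx0 !mul0mx !addr0 add0r mulmx1 (unitarymxP Uu) -scalar_mx_block.
Qed.

Lemma block_inflate d (Q M : 'M[C]_(1 + d)) x (U D : 'M[C]_d) : Q \is unitarymx ->
  Q *m M *m Q^t* = block_mx x%:M 0 0 (U^t* *m D *m U) ->
  let V := block_mx 1%:M 0 0 U *m Q in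
  M = V^t* *m block_mx x%:M 0 0 D *m V.
Proof.
move=> Qu eM V.
have -> : M = Q^t* *m (Q *m M *m Q^t*) *m Q.
  by rewrite !mulmxA unitarymxCP // mul1mx -mulmxA unitarymxCP // mulmx1.
rewrite eM /V adjmxM !mulmxA; congr (_ *m _); rewrite -!mulmxA; congr (_ *m _).
rewrite tr_block_mx map_block_mx !mulmx_block adjmx1 !trmx0 !map_mx0.
by rewrite !(mulmx0, mul0mx, addr0, add0r, mulmx1, mul1mx).
Qed.

(** After normalising [v], complete it to an orthonormal basis. As [A] is Hermitian, it preserves
    the orthogonal complement of [v], and the Gram matrix of [Z] vanishes on [v], so both become
    block diagonal. *)
Lemma deflate d p (A : 'M[C]_d.+1) (Z : 'M[C]_(p, d.+1)) x (v : 'rV_d.+1) :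
  A^t* = A -> conjC x = x -> v != 0 -> v *m A = x *: v -> v *m Z^t* = 0 ->
  exists Q : 'M[C]_(1 + d), exists A' : 'M[C]_d, exists Z' : 'M[C]_(p, d),
  [/\ Q \is unitarymx, (\rank Z' <= \rank Z)%N,
      Q *m A *m Q^t* = block_mx x%:M 0 0 A',
      Q *m (Z^t* *m Z) *m Q^t* = block_mx 0%:M 0 0 (Z'^t* *m Z')
    & Q *m (A + Z^t* *m Z) *m Q^t* = block_mx x%:M 0 0 (A' + Z'^t* *m Z')].
Proof.
move=> hA hx v0; wlog vu : v v0 / v \is unitarymx => [hw vA vZ|vA vZ].
  have q0 := qform1_gt0 v0; set q := qform _ _ in q0.
  pose s : C := (sqrtC q)^-1.
  have s0 : 0 < s by rewrite invr_gt0 sqrtC_gt0.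
  apply: (hw (s *: v)).
  - by rewrite scaler_eq0 negb_or (gt_eqF s0).
  - apply/unitarymxP; rewrite linearZ /= map_mxZ -scalemxAl -scalemxAr scalerA /=.
    have -> : conjC s = s by apply/CrealP/ger0_real/ltW.
    rewrite -expr2 exprVn sqrtCK.
    rewrite [v *m _]mx11_scalar -[v in v *m _]mulmx1 -/(qform _ _) -/q.
    by rewrite scale_scalar_mx mulVf // (gt_eqF q0).
  - by rewrite -scalemxAl vA scalerA mulrC -scalerA.
  - by rewrite -scalemxAl vZ scaler0.
have [K Qu] := unitary_first_row vu; set Q := col_mx v K in Qu.
exists Q, (K *m A *m K^t*), (Z *m K^t*).
have [vv vK Kv KK] : [/\ v *m v^t* = 1%:M, v *m K^t* = 0, K *m v^t* = 0
    & K *m K^t* = 1%:M].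
  have := unitarymxP Qu; rewrite /Q tr_col_mx map_row_mx mul_col_row.
  by rewrite [RHS]scalar_mx_block => /eq_block_mx[].
have Av : A *m v^t* = x *: v^t*.
  by rewrite -{1}hA -adjmxM vA linearZ /= map_mxZ /= hx.
have Zv : Z *m v^t* = 0 by rewrite -[Z]trmxCK -adjmxM vZ trmx0 map_mx0.
have eA : Q *m A *m Q^t* = block_mx x%:M 0 0 (K *m A *m K^t*).
  rewrite /Q tr_col_mx map_row_mx mul_col_mx mul_col_row vA -!scalemxAl vv vK.
  by rewrite -[K *m A *m v^t*]mulmxA Av -scalemxAr Kv !scaler0 scalemx1.
have eZ : Q *m (Z^t* *m Z) *m Q^t* =
    block_mx 0%:M 0 0 ((Z *m K^t*)^t* *m (Z *m K^t*)).
  rewrite /Q tr_col_mx map_row_mx mul_col_mx mul_col_row !mulmxA vZ !mul0mx.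
  rewrite -[_ *m Z *m v^t*]mulmxA Zv mulmx0 adjmxM trmxCK ?mulmxA.
  by congr block_mx; rewrite raddf0.
split => //; first exact: mxrankM_maxl.
rewrite mulmxDr mulmxDl eA eZ add_block_mx !addr0.
by congr block_mx; rewrite -raddfD /= addr0.
Qed.

End Deflation.

(** * Perturbations attaining the optimal spectrum *)

Section OptimalStructure.
Variable R : rcfType.
Local Notation C := R[i].

Lemma spec_deflate d (Q M : 'M[C]_(1 + d)) x (M' : 'M[C]_d) l : Q \is unitarymx ->
  Q *m M *m Q^t* = block_mx (x%:C)%:M 0 0 M' -> spec M (x :: l) -> spec M' l.
Proof.
move=> Qu eM [hM cM]; split.
  have := congr1 (fun X => X^t*) eM.
  rewrite !adjmxM trmxCK hM mulmxA eM tr_block_mx map_block_mx.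
  by case/eq_block_mx.
have : char_poly (Q *m M *m Q^t*) = char_poly M.
  rewrite -{1}[Q]trmxCK; apply: char_poly_conj.
  by rewrite trmxC_unitary.
rewrite eM char_poly_deflate cM big_cons => /mulfI -> //.
by rewrite polyXsubC_eq0.
Qed.

Lemma rdiag_cons d (x : R) l :
  rdiag d.+1 (x :: l) = block_mx (x%:C)%:M 0 0 (rdiag d l) :> 'M[C]_(1 + d).
Proof.
rewrite /rdiag -diag_const_mx -diag_mx_row; congr diag_mx.
apply/rowP => i; rewrite !mxE; case: splitP => j ->; rewrite !mxE //=.
by rewrite ord1.
Qed.

Lemma diag_inflate d (Q M : 'M[C]_(1 + d)) x (U : 'M[C]_d) l : Q \is unitarymx ->
  Q *m M *m Q^t* = block_mx (x%:C)%:M 0 0 (U^t* *m rdiag d l *m U) ->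
  let V := block_mx 1%:M 0 0 U *m Q in M = V^t* *m rdiag d.+1 (x :: l) *m V.
Proof. by move=> Qu eM; rewrite rdiag_cons; exact: (block_inflate Qu eM). Qed.

Lemma spec_const d (M : 'M[C]_d) l (c : R) : spec M l -> all (pred1 c) l ->
  M = (c%:C)%:M.
Proof.
move=> sM /allP al; have sl := spec_size sM; have [U Uu ->] := spec_diag sM.
have -> : rdiag d l = (c%:C)%:M.
  rewrite -diag_const_mx /rdiag; congr diag_mx; apply/rowP => i; rewrite !mxE.
  by congr (_%:C); apply/eqP/al/mem_nth; rewrite sl.
by rewrite scalar_mxC mul_scalar_mx -scalemxAl unitarymxCP // scalemx1.
Qed.

(* At each step a common eigenvector [v], with [v Z^* = 0], is split off: a top
   eigenvector of [A] as long as its eigenvalue is at least [c], and otherwise a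
   vector of [ker Z] in the span of [m + 1] eigenvectors of [A + Z^* Z]. *)
Theorem optimal_structure c m d p (A : 'M[C]_d) (Z : 'M[C]_(p, d)) a :
  sorted >=%R a -> (\rank Z <= m)%N -> spec A a ->
  spec (A + Z^t* *m Z) (fill c m a) ->
  exists U : 'M[C]_d, [/\ U \is unitarymx, A = U^t* *m rdiag d a *m U
    & Z^t* *m Z = U^t* *m rdiag d (pad c m a) *m U].
Proof.
elim: d A Z a => [|d IH] A Z a sa rZ sA sX.
  exists 1%:M; split; first by apply/unitarymxP/matrixP => -[].
  - by apply/matrixP => -[].
  - by apply/matrixP => -[].
have za := spec_size sA.
case: a sa za sA sX => [//|a0 a] sa za sA sX.
have ssa := path_sorted sa.
have aa0 : all (<= a0) (a0 :: a) by rewrite /= lexx path_ge_all.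
have [U Uu eA] := spec_diag sA.
have A_le (v : 'rV[C]_d.+1) : qform A v <= a0%:C * qform 1%:M v.
  rewrite eA; apply: (qform_le Uu) => i _.
  by move/allP: aa0; apply; apply: mem_nth; rewrite za.
have step (v : 'rV[C]_d.+1) : v != 0 -> v *m A = a0%:C *: v -> v *m Z^t* = 0 ->
    fill c m (a0 :: a) = a0 :: fill c m a ->
    pad c m (a0 :: a) = 0 :: pad c m a ->
    exists U : 'M[C]_d.+1, [/\ U \is unitarymx,
      A = U^t* *m rdiag d.+1 (a0 :: a) *m U
    & Z^t* *m Z = U^t* *m rdiag d.+1 (pad c m (a0 :: a)) *m U].
  move=> v0 vA vZ ef ep; rewrite ef in sX; rewrite ep.
  have [Q [A' [Z' [Qu rZ' eQA eQZ eQX]]]] :=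
    deflate (spec_herm sA) (conjC_real a0) v0 vA vZ.
  have sA' := spec_deflate Qu eQA sA.
  have sX' := spec_deflate Qu eQX sX.
  have [U' [Uu' eA' eZ']] := IH _ _ _ ssa (leq_trans rZ' rZ) sA' sX'.
  exists (block_mx 1%:M 0 0 U' *m Q); split.
  - exact: mul_unitarymx (unitary_block1 Uu') Qu.
  - by apply: diag_inflate Qu _; rewrite -eA'.
  - by apply: diag_inflate Qu _; rewrite -eZ'.
have [ca|ac] := leP c a0.
  have e0 : row 0 U *m U^t* = row 0 1%:M by rewrite -row_mul (unitarymxP Uu).
  have v0 : row 0 U != 0.
    apply/eqP => h; move: e0; rewrite h mul0mx => /rowP/(_ 0)/eqP.
    by rewrite !mxE eq_sym oner_eq0.
  have vA : row 0 U *m A = a0%:C *: row 0 U.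
    rewrite {1}eA !mulmxA e0.
    suff -> : row 0 1%:M *m rdiag d.+1 (a0 :: a) = a0%:C *: row 0 1%:M.
      by rewrite -scalemxAl -row_mul mul1mx.
    apply/rowP => j; rewrite mul_mx_diag !mxE.
    by case: eqVneq => [<-|]; rewrite ?mulr0n ?mul0r ?mulr0 // mul1r mulr1.
  apply: (step _ v0 vA).
  (* All eigenvalues of the perturbed matrix are at most [a0], while [A] alone already gives [a0] on
     [v]; the contribution of [Z] must be zero. *)
  - apply/eqP; rewrite -qform1_eq0 -qform_gram.
    rewrite eq_le qform_gram qform1_ge0 andbT -qform_gram.
    have [U' Uu' eX] := spec_diag sX.
    rewrite -(lerD2l (qform A (row 0 U))) -qformD addr0.
    have -> : qform A (row 0 U) = a0%:C * qform 1%:M (row 0 U).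
      by rewrite /qform vA -!scalemxAl mxE mulmx1.
    rewrite eX; apply: (qform_le Uu') => i _.
    have /allP := fill_le m ca aa0; apply; apply: mem_nth.
    by rewrite size_fill za.
  - by rewrite /= (max_idPl ca) if_same.
  - by rewrite /= (max_idPl ca) subrr if_same.
have aac : all (<= c) (a0 :: a).
  by apply: sub_all aa0 => y yx; apply: le_trans yx (ltW ac).
have [ma|am] := leqP m (size a).
  (* Listing the [m] copies of [c] first makes [a0] the entry of index [m], so the form of the sum
     is at least [a0] on the first [m + 1] eigenvectors, whose span meets the kernel of [Z]. *)
  have sX' : spec (A + Z^t* *m Z) (nseq m c ++ take ((size a).+1 - m) (a0 :: a)).
    apply: spec_perm sX; rewrite fill_above // perm_catC.
    by rewrite (minn_idPl (leqW ma)).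
  have [U' Uu' eX] := spec_diag sX'.
  have [|v v0 /mul_row_mx_eq0[vZ vU']] := @exists_kernel_vector _ _ _
      (row_mx (Z^t*) (U'^t* *m copid_mx m.+1)).
    apply: leq_ltn_trans (rank_row_mx _ _) _; rewrite rank_adjmx.
    have md : (m.+1 <= d.+1)%N by case: za => <-.
    apply: leq_ltn_trans (leq_add rZ (rank_mul_copid _ md)) _.
    by rewrite subSS subnKC.
  (* On [v] the forms of [A] and of the sum agree, so [v] attains the maximum [a0] of the form of
     [A] and is an eigenvector. *)
  have eq : qform A v = a0%:C * qform 1%:M v.
    apply/le_anti; rewrite A_le /=.
    have -> : qform A v = qform (A + Z^t* *m Z) v.
      by rewrite qformD qform_gram vZ qform0 addr0.
    rewrite eX; apply: (qform_ge Uu') => i /(mul_copid_eq0 vU') im.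
    rewrite nth_cat size_nseq nth_nseq; case: ltnP => mi; first exact: ltW.
    have -> : (i - m = 0)%N by lia.
    by rewrite subSn //= lexx.
  apply: (step v v0 _ vZ); rewrite /= ?ma //.
  rewrite {1}eA; apply: (qform_max_eigen Uu) => [i _|]; last by rewrite -eA.
  by move/allP: aa0; apply; apply: mem_nth; rewrite za.
(* Now [m] is at least the length of the whole list, so every entry is raised to [c] and the sum is
   scalar; any diagonalisation of [A] also diagonalises the perturbation. *)
exists U; split; [exact: Uu|exact: eA|].
have cX : A + Z^t* *m Z = (c%:C)%:M.
  apply: spec_const sX _; rewrite fill_above //=.
  have -> : ((size a).+1 - m = 0)%N by lia.
  by rewrite take0 all_pred1_nseq.
have -> : Z^t* *m Z = (c%:C)%:M - A by rewrite -cX addrAC subrr add0r.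
have -> : rdiag d.+1 (pad c m (a0 :: a)) = (c%:C)%:M - rdiag d.+1 (a0 :: a).
  rewrite -diag_const_mx /rdiag -linearB; congr diag_mx; apply/rowP => i.
  rewrite !mxE nth_pad rmorphB; congr (_%:C - _).
  have /all_pred1P : all (pred1 c) (fill c m (a0 :: a)).
    rewrite fill_above //=; have -> : ((size a).+1 - m = 0)%N by lia.
    by rewrite take0 all_pred1_nseq.
  by rewrite size_fill za => ->; rewrite nth_nseq ltn_ord.
rewrite mulmxBr mulmxBl -eA; congr (_ - _).
by rewrite scalar_mxC mul_scalar_mx -scalemxAl unitarymxCP // scalemx1.
Qed.

End OptimalStructure.

(** * Water level and convex sums *)

Section WaterLevel.
Variable R : realType.

Lemma fill0 m (a : seq R) : all (>= 0) a -> fill 0 m a = a.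
Proof.
elim: a => //= x a IH /andP[x0 /IH ->].
by rewrite (max_idPl x0) if_same.
Qed.

Lemma continuous_fill_sum m (a : seq R) :
  continuous (fun c : R => \sum_(z <- fill c m a) z).
Proof.
elim: a => [|x a IH] /= c.
  rewrite (_ : (fun c => _) = fun=> 0); first exact: cvg_cst.
  by apply: funext => c'; rewrite big_nil.
rewrite (_ : (fun c => _) = (fun c => if (m <= size a)%N then x else Num.max x c)
   \+ (fun c => \sum_(z <- fill c m a) z)); last first.
  by apply: funext => c'; rewrite big_cons.
apply: continuousD; last exact: IH.
case: (m <= size a)%N; first exact: cvg_cst.
by apply: (@continuous_max R R (fun=> x) id c); [exact: cvg_cst|exact: cvg_id].
Qed.

(** The last entry is always raised when [m] is positive, and by at least [T]; the other increments
    are nonnegative. *)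
Lemma fill_sum_large m (a : seq R) c T : a != [::] -> (0 < m)%N ->
  (forall x, x \in a -> x + T <= c) -> 0 <= T ->
  \sum_(z <- a) z + T <= \sum_(z <- fill c m a) z.
Proof.
move=> + m0 + T0; elim: a => // x [|y a] IH _ hc.
  rewrite /= leqNgt m0 /= !big_seq1 le_max hc ?orbT //.
  by rewrite mem_seq1.
have -> : fill c m (x :: y :: a) =
    (if (m <= (size a).+1)%N then x else Num.max x c) :: fill c m (y :: a) by [].
rewrite big_cons [leRHS]big_cons -addrA lerD //.
  by case: ifP => // _; rewrite le_max lexx.
by apply: IH => // z za; apply: hc; rewrite in_cons za orbT.
Qed.

(** Intermediate value theorem between level 0, where nothing is raised, and the target sum, which
    exceeds every entry by at least [T]. For [T = 0] the level 0 works even if no entry can be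
    raised. *)
Lemma exists_water_level m (a : seq R) T : all (>= 0) a -> 0 <= T ->
  (0 < T -> a != [::] /\ (0 < m)%N) ->
  exists2 c, 0 <= c & \sum_(z <- fill c m a) z = \sum_(z <- a) z + T.
Proof.
move=> a0; rewrite le_eqVlt => /predU1P[<- _|T0 /(_ T0)[an m0]].
  by exists 0; rewrite ?fill0 ?addr0.
pose f c : R := \sum_(z <- fill c m a) z.
pose M := \sum_(z <- a) z + T.
have x_le x : x \in a -> x <= \sum_(z <- a) z.
  move=> xa; rewrite (perm_big _ (perm_to_rem xa)) big_cons /= lerDl.
  rewrite big_seq; apply: sumr_ge0 => z /mem_rem za.
  by move/allP: a0; apply.
have M0 : 0 <= M.
  rewrite addr_ge0 ?(ltW T0) // big_seq; apply: sumr_ge0 => z za.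
  by move/allP: a0; apply.
have f0 : f 0 = \sum_(z <- a) z by rewrite /f fill0.
have fM : M <= f M.
  apply: fill_sum_large => // [x xa|]; last exact: ltW.
  by rewrite lerD2r x_le.
have [||c] := @IVT R f 0 M M M0.
- apply: continuous_subspaceT; exact: continuous_fill_sum.
- by rewrite ge_min le_max fM orbT f0 /M lerDl ltW.
- by rewrite in_itv /= => /andP[c0 _] fc; exists c.
Qed.

End WaterLevel.

(** * Subgradients and comparison of convex sums *)

Section ConvexPotential.
Variable R : realType.
Variable h : R -> R.

Lemma Conv_ineq (x y s : R) : Conv h -> 0 <= x -> 0 <= y -> 0 <= s <= 1 ->
  h (s * x + (1 - s) * y) <= s * h x + (1 - s) * h y.
Proof.
move=> [_ hc] x0 y0 /andP[s0 s1].
have in_D (z : R) : 0 <= z -> z \in (`[0, +oo[%classic : set R).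
  by move=> z0; rewrite inE /= in_itv /= z0.
exact: hc (Itv01 s0 s1) _ _ (in_D _ x0) (in_D _ y0).
Qed.

Lemma Conv_slopes (y c z : R) : Conv h -> 0 <= y -> y < c -> c < z ->
  (h c - h y) * (z - c) <= (h z - h c) * (c - y).
Proof.
move=> hc y0 yc cz; have zy : 0 < z - y by lra.
pose s := (z - c) / (z - y).
have e : s * y + (1 - s) * z = c by rewrite /s; field; rewrite gt_eqF.
have s01 : 0 <= s <= 1.
  by rewrite divr_ge0 ?ler_pdivrMr ?mul1r //=; lra.
have z0 : 0 <= z by lra.
have := Conv_ineq hc y0 z0 s01.
rewrite e -(ler_pM2r zy) => {}e.
have e1 : (s * h y + (1 - s) * h z) * (z - y) = (z - c) * h y + (c - y) * h z.
  by rewrite /s; field; rewrite gt_eqF.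
by rewrite e1 in e; lra.
Qed.

(** The slope is the infimum of the chord slopes to the right of [c]. Monotonicity bounds these
    below by 0, so the infimum exists also at [c = 0], where there are no chords to the left. *)
Lemma subgradient (c : R) : Conv h -> nondecreasing_nneg h -> 0 <= c ->
  exists2 s, 0 <= s & forall y, 0 <= y -> h c + s * (y - c) <= h y.
Proof.
move=> hc hn c0.
pose E := [set (h z - h c) / (z - c) | z in [set z | c < z]].
have E0 : E !=set0.
  by exists ((h (c + 1) - h c) / (c + 1 - c)), (c + 1) => //=; rewrite ltrDl.
have lbE : lbound E 0.
  move=> _ [z /= cz <-]; rewrite divr_ge0 ?subr_ge0 ?(ltW cz) //.
  by rewrite hn // ltW.
exists (inf E); first exact: lb_le_inf.
move=> y y0; have [cy|yc|->] := ltgtP c y; last by rewrite subrr mulr0 addr0.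
  have : inf E <= (h y - h c) / (y - c) by apply: ge_inf; [exists 0|exists y].
  by rewrite ler_pdivlMr ?subr_gt0 //; lra.
have : (h c - h y) / (c - y) <= inf E.
  apply: lb_le_inf => // _ [z /= cz <-].
  rewrite ler_pdivlMr ?subr_gt0 // mulrAC ler_pdivrMr ?subr_gt0 //.
  exact: Conv_slopes.
by rewrite ler_pdivrMr ?subr_gt0 //; lra.
Qed.

(** The tilted function [h y - s * y] is convex and minimal at [c], so it does not decrease on the
    way from [c] through [nu] to [x]. *)
Lemma tilt_between (c s nu x : R) : Conv h -> 0 <= c -> 0 <= x ->
  (forall y, 0 <= y -> h c + s * (y - c) <= h y) ->
  (c <= nu <= x) || (x <= nu <= c) -> h nu - s * nu <= h x - s * x.
Proof.
move=> hc c0 x0 hs b.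
have [xc|xc] := eqVneq x c.
  suff -> : nu = x by [].
  by move: b; rewrite xc => /orP[] /andP[? ?]; lra.
have xc0 : x - c != 0 by rewrite subr_eq0.
pose u := (x - nu) / (x - c).
have e : u * c + (1 - u) * x = nu by rewrite /u; field.
have u01 : 0 <= u <= 1.
  have [cx|cx] : (0 < x - c) \/ (0 < c - x).
  - by move: xc; rewrite neq_lt => /orP[] ?; [right|left]; rewrite subr_gt0.
  - by rewrite /u divr_ge0 ?ler_pdivrMr //; case/orP: b => /andP[? ?]; lra.
  - have -> : u = (nu - x) / (c - x) by rewrite /u; field; lra.
    by rewrite divr_ge0 ?ler_pdivrMr //; case/orP: b => /andP[? ?]; lra.
have := Conv_ineq hc c0 x0 u01; rewrite e => hnu.
have k0 := hs x x0; case/andP: u01 => u0 u1.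
have : 0 <= u * (h x - h c - s * (x - c)) by apply: mulr_ge0 => //; lra.
by rewrite -e in hnu *; nra.
Qed.

Lemma tilt_between_strict (c s nu x : R) : strictly_convex_nneg h ->
  0 <= c -> 0 <= x -> (forall y, 0 <= y -> h c + s * (y - c) <= h y) ->
  (c <= nu <= x) || (x <= nu <= c) -> nu != x -> h nu - s * nu < h x - s * x.
Proof.
move=> hc c0 x0 hs b nx.
have xc : x != c.
  apply: contraNneq nx => xc.
  by move: b; rewrite xc => /orP[] /andP[? ?]; apply/eqP; lra.
have cx : c != x by rewrite eq_sym.
(* If [nu = c], strict convexity at the midpoint of [c] and [x] is combined with the subgradient
   inequality there. *)
have [nc|nc] := eqVneq nu c.
  have := hc (2^-1) c x; rewrite nc => /(_ _ c0 x0 cx) H.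
  have {}H := H ltac:(lra).
  have := hs (2^-1 * c + (1 - 2^-1) * x); lra.
have xc0 : x - c != 0 by rewrite subr_eq0.
pose u := (x - nu) / (x - c).
have e : u * c + (1 - u) * x = nu by rewrite /u; field.
have u01 : 0 < u < 1.
  have [d|d] : (0 < x - c) \/ (0 < c - x).
  - by move: xc; rewrite neq_lt => /orP[] ?; [right|left]; rewrite subr_gt0.
  - have [p q] : c < nu /\ nu < x.
      by rewrite !lt_neqAle nx eq_sym nc /=; case/orP: b => /andP[? ?]; split; lra.
    by rewrite /u divr_gt0 ?ltr_pdivrMr //; lra.
  - have -> : u = (nu - x) / (c - x) by rewrite /u; field; lra.
    have [p q] : x < nu /\ nu < c.
      rewrite !lt_neqAle nc eq_sym nx /=; case/orP: b => /andP[? ?]; split; lra.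
    by rewrite divr_gt0 ?ltr_pdivrMr //; lra.
have := hc u c x u01 c0 x0 cx; rewrite e => hnu.
have k0 := hs x x0; case/andP: u01 => u0 u1.
have : 0 <= u * (h x - h c - s * (x - c)) by apply: mulr_ge0; lra.
by rewrite -e in hnu *; nra.
Qed.

(** Summing the tilted inequalities leaves [s] times the difference of the two sums, which has the
    right sign because [s] is nonnegative. One index with [nu i] different from [x i] would make the
    inequality strict. *)
Lemma sum_between d (c : R) (nu x : 'I_d -> R) : Conv h ->
  nondecreasing_nneg h -> 0 <= c -> (forall i, 0 <= x i) ->
  (forall i, (c <= nu i <= x i) || (x i <= nu i <= c)) ->
  \sum_i nu i <= \sum_i x i ->
  \sum_i h (nu i) <= \sum_i h (x i) /\
  (strictly_convex_nneg h -> \sum_i h (nu i) = \sum_i h (x i) -> nu =1 x).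
Proof.
move=> hc hn c0 x0 b sum_le; have [s s0 hs] := subgradient hc hn c0.
have t i : h (nu i) - s * nu i <= h (x i) - s * x i by apply: tilt_between (b i).
have T : \sum_i (h (nu i) - s * nu i) <= \sum_i (h (x i) - s * x i).
  by apply: ler_sum.
have S : s * \sum_i nu i <= s * \sum_i x i by rewrite ler_wpM2l.
split; first by move: T S; rewrite !sumrB -!mulr_sumr; lra.
move=> hsc e i; apply/eqP/negPn/negP => ne.
have : \sum_i (h (nu i) - s * nu i) < \sum_i (h (x i) - s * x i).
  rewrite (bigD1 i) //= [ltRHS](bigD1 i) //=; apply: ltr_leD.
    exact: tilt_between_strict (b i) ne.
  by apply: ler_sum.
by move: S; rewrite !sumrB -!mulr_sumr e; lra.
Qed.

End ConvexPotential.

(** * Finite-dimensional subspaces and operators on them *)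

Local Open Scope card_scope.

Section Synthesis.
Variables (R : realType) (H : completeNormedModType R[i]).
Local Notation C := R[i].

Lemma synthesis_linear n (b : 'I_n -> H) : linear (synthesis_op b).
Proof.
move=> k u v; rewrite /synthesis_op scaler_sumr -big_split; apply: eq_bigr => i _.
by rewrite !mxE scalerDl scalerA.
Qed.

HB.instance Definition _ n (b : 'I_n -> H) :=
  GRing.isLinear.Build C 'rV[C]_n H *:%R (synthesis_op b) (synthesis_linear b).

Lemma synthesis_mul n k (b : 'I_n -> H) (M : 'M[C]_(k, n)) (a : 'rV_k) :
  synthesis_op (fun i => synthesis_op b (row i M)) a = synthesis_op b (a *m M).
Proof.
rewrite mulmx_sum_row linear_sum; apply: eq_bigr => i _.
by rewrite linearZ.
Qed.

Lemma synthesis_delta n (b : 'I_n -> H) i : synthesis_op b (delta_mx 0 i) = b i.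
Proof.
rewrite /synthesis_op (bigD1 i) //= big1 ?addr0 => [|j ji].
  by rewrite mxE !eqxx scale1r.
by rewrite mxE (negPf ji) andbF scale0r.
Qed.

Lemma span_mem n (b : 'I_n -> H) i : lin_span b (b i).
Proof. by exists (delta_mx 0 i); rewrite ?synthesis_delta. Qed.

Lemma mulmx_eq1 n (M : 'M[C]_n) : (forall a : 'rV_n, a *m M = a) -> M = 1%:M.
Proof. by move=> h; apply/row_matrixP => i; rewrite row1 rowE h. Qed.

Lemma span_coeffs n k (b : 'I_n -> H) (c : 'I_k -> H) :
  (forall i, lin_span b (c i)) ->
  exists M : 'M[C]_(k, n), forall i, c i = synthesis_op b (row i M).
Proof.
move=> h; have /choice[f hf] : forall i, exists a, synthesis_op b a = c i.
  by move=> i; have [a _ e] := h i; exists a.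
by exists (\matrix_i f i) => i; rewrite rowK hf.
Qed.

Lemma basis_size_le (V : set H) k l (b : 'I_k -> H) (c : 'I_l -> H) :
  basis_of_set b V -> basis_of_set c V -> (k <= l)%N.
Proof.
move=> [ib eb] [ic ec].
have [|M hM] := @span_coeffs _ _ c b.
  by move=> i; rewrite ec -eb; exact: span_mem.
have [|N hN] := @span_coeffs _ _ b c.
  by move=> i; rewrite eb -ec; exact: span_mem.
apply: (@mulmx1_min _ _ _ M N); apply: mulmx_eq1 => a; apply: ib.
by rewrite mulmxA -synthesis_mul -(funext hN) -synthesis_mul -(funext hM).
Qed.

Lemma has_dim_uniq (V : set H) k l : has_dim V k -> has_dim V l -> k = l.
Proof.
move=> [b hb] [c hc]; apply/eqP.
by rewrite eqn_leq (basis_size_le hb hc) (basis_size_le hc hb).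
Qed.

Lemma dim_ofE (V : set H) k : has_dim V k -> dim_of V = k.
Proof.
by move=> hk; apply: (xget_unique 0%N hk) => l hl; apply: has_dim_uniq hl hk.
Qed.

End Synthesis.

(** * Uniqueness of sorted lists with given multiplicities *)

Section SortedLists.
Variable R : realType.

(** At a first index [j] with [u j > v j], all occurrences of the value [u j] in [v] come before
    [j], hence also occur in [u], which has one more at [j]; the multiplicities then differ. Only
    positive values are counted, as 0 occurs infinitely often in a padded list. *)
Lemma eqlist_uniq (u v : nat -> R) : nonincreasing_seq u -> nonincreasing_seq v ->
  (forall i, 0 <= u i) -> (forall i, 0 <= v i) ->
  (forall c, 0 < c -> exists k : nat, [set i | u i = c] #= `I_k /\
      [set i | v i = c] #= `I_k) -> u = v.
Proof.
suff key (u' v' : nat -> R) j : nonincreasing_seq v' ->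
    (forall i, 0 <= v' i) -> (forall i, (i < j)%N -> u' i = v' i) ->
    (forall c, 0 < c -> exists k : nat, [set i | u' i = c] #= `I_k /\
                                [set i | v' i = c] #= `I_k) -> u' j <= v' j.
  move=> nu nv u0 v0 h; apply: funext => j.
  elim/ltn_ind: j => j IH; apply/le_anti.
  rewrite !key // => [i ij|c c0]; first by rewrite IH.
  by have [k [ku kv]] := h c c0; exists k.
move=> nv v0 IH h; rewrite leNgt; apply/negP => vu.
have [k [ku kv]] := h _ (le_lt_trans (v0 j) vu).
have fu : finite_set [set i | u' i = u' j] by apply/finite_setP; exists k.
have fv : finite_set [set i | v' i = u' j] by apply/finite_setP; exists k.
have sub : [set i | v' i = u' j] `<=` [set i | u' i = u' j].
  move=> i /= vi; rewrite IH //.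
  by rewrite ltnNge; apply/negP => ji; have := nv _ _ ji; rewrite vi leNgt vu.
suff /seteqP[_ /(_ j erefl) /= e] :
    [set i | v' i = u' j] = [set i | u' i = u' j].
  by rewrite e ltxx in vu.
apply: (fset_set_inj fv fu); apply/eqP.
rewrite (fset_set_sub fv fu) in sub.
by rewrite eqEfcard sub (card_fset_set ku) (card_fset_set kv) leqnn.
Qed.

Lemma sorted_ffun_uniq d (u v : {ffun 'I_d -> R}) :
  (forall i j : 'I_d, (i <= j)%N -> u j <= u i) ->
  (forall i j : 'I_d, (i <= j)%N -> v j <= v i) ->
  (forall c, #|[set i | u i == c]%SET| = #|[set i | v i == c]%SET|) -> u = v.
Proof.
suff key (u' v' : {ffun 'I_d -> R}) (j : 'I_d) :
    (forall i j : 'I_d, (i <= j)%N -> v' j <= v' i) ->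
    (forall i : 'I_d, (i < j)%N -> u' i = v' i) ->
    (forall c, #|[set i | u' i == c]%SET| = #|[set i | v' i == c]%SET|) ->
    u' j <= v' j.
  move=> nu nv h; apply/ffunP => j; move: {2}(val j) (erefl (val j)) => m.
  elim/ltn_ind: m j => m IH j jm; apply/le_anti.
  by rewrite !key // => i; rewrite jm => im; rewrite (IH _ im).
move=> nv IH h; rewrite leNgt; apply/negP => vu.
suff /proper_card : ([set i | v' i == u' j] \proper [set i | u' i == u' j])%SET.
  by rewrite h ltnn.
apply/properP; split.
  apply/fintype.subsetP => i; rewrite !inE => /eqP vi; rewrite IH ?vi //.
  by rewrite ltnNge; apply/negP => ji; have := nv _ _ ji; rewrite vi leNgt vu.
by exists j; rewrite inE ?eqxx // lt_eqF.
Qed.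

End SortedLists.

(** * Inner products and existence of orthonormal bases *)

Section InnerProduct.
Variables (R : realType) (H : completeNormedModType R[i]).
Variable dot : {dot H for (@conjC R[i])}.
Local Notation C := R[i].

Lemma dotC u v : dot u v = conjC (dot v u).
Proof. by rewrite hermC /= expr0 mul1r. Qed.

Lemma dotZl k u v : dot (k *: u) v = k * dot u v.
Proof. by rewrite linearZl_LR. Qed.

Lemma dotZr k u v : dot u (k *: v) = conjC k * dot u v.
Proof. by rewrite linearZr_LR. Qed.

Lemma dot_synthesisl n (b : 'I_n -> H) a f :
  dot (synthesis_op b a) f = (a *m (analysis_op dot b f)^t*) 0 0.
Proof.
by rewrite analysis_adjoint mxE; apply: eq_bigr => i _; rewrite adjmxE.
Qed.

Lemma dot_synthesisr n (b : 'I_n -> H) a f :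
  dot f (synthesis_op b a) = (analysis_op dot b f *m a^t*) 0 0.
Proof.
rewrite dotC dot_synthesisl -adjmxE adjmxM trmxCK.
by [].
Qed.

Lemma analysis_linear n (b : 'I_n -> H) : linear (analysis_op dot b).
Proof. by move=> k u v; apply/rowP => i; rewrite !mxE linearPl. Qed.

HB.instance Definition _ n (b : 'I_n -> H) :=
  GRing.isLinear.Build C H 'rV[C]_n *:%R (analysis_op dot b) (analysis_linear b).

Lemma analysis_synthesis n k (b : 'I_n -> H) (c : 'I_k -> H) a :
  analysis_op dot b (synthesis_op c a) = a *m \matrix_(i, j) dot (c i) (b j).
Proof.
apply/rowP => j; rewrite !mxE linear_sumlz; apply: eq_bigr => i _.
by rewrite linearZl_LR mxE.
Qed.

Lemma gram_adj n k (b : 'I_n -> H) (c : 'I_k -> H) :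
  (\matrix_(i, j) dot (b i) (c j))^t* = \matrix_(i, j) dot (c i) (b j).
Proof. by apply/matrixP => i j; rewrite adjmxE !mxE -dotC. Qed.

(* The Gram matrix of a basis is diagonalised by a unitary matrix; rescaling
   the resulting orthogonal basis gives an orthonormal one. *)
Lemma exists_onb d (V : set H) : has_dim V d ->
  exists e : 'I_d -> H, orthonormal_basis dot e V.
Proof.
move=> [b [ib eb]]; pose G : 'M[C]_d := \matrix_(i, j) dot (b i) (b j).
have [U [l Uu [sl eG]]] := spec_exists (gram_adj b b : G^t* = G).
pose g i := synthesis_op b (row i U).
have gg i j : dot (g i) (g j) = (i == j)%:R * (nth 0 l i)%:C.
  rewrite dot_synthesisr analysis_synthesis -/G eG.
  have -> : row i U *m (U^t* *m rdiag d l *m U) *m (row j U)^t* =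
      row i (U *m U^t*) *m rdiag d l *m (row j (U *m U^t*))^t*.
    by rewrite !row_mul adjmxM trmxCK !mulmxA.
  rewrite (unitarymxP Uu) mul_mx_diag !mxE (bigD1 j) //= big1 ?addr0 => [|k kj].
    rewrite !adjmxE !mxE eqxx /=.
    rewrite rmorph1 mulr1.
    by have [->|] := eqVneq i j; rewrite // !mul0r.
  by rewrite adjmxE !mxE [j == k]eq_sym (negPf kj) rmorph0 mulr0.
have g0 i : g i != 0.
  apply/eqP => gi0.
  have /ib /rowP U0 : synthesis_op b (row i U) = synthesis_op b 0.
    by rewrite [RHS]linear0.
  have := congr1 (fun M : 'M[C]_d => M i i) (unitarymxP Uu).
  rewrite !mxE eqxx big1 => [|j _]; first by move/eqP; rewrite eq_sym oner_eq0.
  by have := U0 j; rewrite !mxE => ->; rewrite mul0r.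
have l0 (i : 'I_d) : 0 < (nth 0 l i)%:C :> C.
  by have := gg i i; rewrite eqxx mul1r => <-; rewrite dnorm_gt0 g0.
pose s (i : 'I_d) : C := (sqrtC (nth 0 l i)%:C)^-1.
have s0 i : 0 < s i by rewrite invr_gt0 sqrtC_gt0.
have cs i : conjC (s i) = s i by apply/CrealP/ger0_real/ltW.
pose e i := s i *: g i.
exists e; split.
  move=> i j; rewrite dotZl dotZr gg cs.
  have [->|] := eqVneq i j; rewrite ?mul0r ?mulr0 //.
  rewrite mul1r mulrA -expr2 exprVn sqrtCK.
  by rewrite mulVf // gt_eqF.
have Te a : synthesis_op e a = synthesis_op b ((\row_i (a 0 i * s i)) *m U).
  rewrite -synthesis_mul; apply: eq_bigr => i _.
  by rewrite mxE /e scalerA.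
apply/seteqP; split => [_ [a _ <-]|x].
  by rewrite Te -eb; exists ((\row_i (a 0 i * s i)) *m U).
rewrite -eb => -[a _ <-]; exists (\row_i ((a *m U^t*) 0 i * (s i)^-1)) => //.
rewrite Te; congr synthesis_op; rewrite -[RHS]mulmx1 -(unitarymxCP Uu) mulmxA.
congr (_ *m _); apply/rowP => i; rewrite !mxE.
by rewrite mulfVK // gt_eqF.
Qed.

End InnerProduct.

(** * Operators and sequences in the coordinates of an orthonormal basis *)

Section Coordinates.
Variables (R : realType) (H : completeNormedModType R[i]).
Variable dot : {dot H for (@conjC R[i])}.
Local Notation C := R[i].
Variables (d : nat) (V : set H) (e : 'I_d -> H).
Hypothesis onb : orthonormal_basis dot e V.

Local Notation co := (analysis_op dot e).
Local Notation T := (synthesis_op e).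

Lemma gram_onb : \matrix_(i, j) dot (e i) (e j) = 1%:M.
Proof. by apply/matrixP => i j; rewrite !mxE onb.1. Qed.

Lemma onb_analysisK a : co (T a) = a.
Proof. by rewrite analysis_synthesis gram_onb mulmx1. Qed.

Lemma onb_mem a : V (T a).
Proof. by rewrite -onb.2; exists a. Qed.

Lemma onb_synthesisK f : V f -> T (co f) = f.
Proof. by rewrite -onb.2 => -[a _ <-]; rewrite onb_analysisK. Qed.

Lemma onb_inj : injective T.
Proof. by apply: can_inj onb_analysisK. Qed.

Lemma onb_dim : has_dim V d.
Proof. by exists e; split; [exact: onb_inj|exact: onb.2]. Qed.

Lemma onb_norm a : dot (T a) (T a) = qform 1%:M a.
Proof. by rewrite dot_synthesisr onb_analysisK /qform mulmx1. Qed.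

Lemma orthocomplP f : orthocompl dot V f <-> co f = 0.
Proof.
split=> [h|cf w /onb_synthesisK <-].
  by apply/rowP => i; rewrite !mxE h // -onb.2; exact: span_mem.
by rewrite dot_synthesisr cf mul0mx mxE.
Qed.

(** The operator on all of [H] that has matrix [M] on [V] and vanishes on the orthogonal complement.
    Acting on rows, it reverses the order of products under composition. *)
Definition mxop (M : 'M[C]_d) (f : H) : H := T (co f *m M).

Lemma mxop_linear M : linear (mxop M).
Proof.
by move=> k u v; rewrite /mxop linearP mulmxDl -scalemxAl linearP.
Qed.

Lemma mxopB M N f : mxop (M - N) f = mxop M f - mxop N f.
Proof. by rewrite /mxop mulmxBr linearB. Qed.

Lemma mxop_comp M N f : mxop M (mxop N f) = mxop (N *m M) f.
Proof. by rewrite /mxop onb_analysisK mulmxA. Qed.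

Lemma mxop_adj M f g : dot (mxop M f) g = dot f (mxop (M^t*) g).
Proof.
by rewrite dot_synthesisl dot_synthesisr adjmxM trmxCK mulmxA.
Qed.

Definition coords n (G : 'I_n -> H) : 'M[C]_(n, d) :=
  \matrix_(i, j) dot (G i) (e j).

Lemma row_coords n (G : 'I_n -> H) i : row i (coords G) = co (G i).
Proof. by apply/rowP => j; rewrite !mxE. Qed.

Lemma coordsK n (G : 'I_n -> H) : (forall i, V (G i)) ->
  forall i, G i = T (row i (coords G)).
Proof. by move=> GV i; rewrite row_coords onb_synthesisK. Qed.

Lemma coords_synthesis n (M : 'M[C]_(n, d)) : coords (fun i => T (row i M)) = M.
Proof. by apply/row_matrixP => i; rewrite row_coords onb_analysisK. Qed.

Lemma synthesis_coords n (G : 'I_n -> H) a : (forall i, V (G i)) ->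
  synthesis_op G a = T (a *m coords G).
Proof. by move=> GV; rewrite -synthesis_mul -(funext (coordsK GV)). Qed.

Lemma frame_op_coords n (G : 'I_n -> H) : (forall i, V (G i)) ->
  frame_op dot G = mxop ((coords G)^t* *m coords G).
Proof.
move=> GV; apply: funext => f; rewrite /frame_op synthesis_coords // /mxop mulmxA.
congr (T (_ *m _)); apply/rowP => i.
by rewrite [LHS]mxE (coordsK GV i) dot_synthesisr mul_row_adj.
Qed.

Lemma sum_dot_coords n (G : 'I_n -> H) : (forall i, V (G i)) ->
  \sum_i dot (G i) (G i) = \tr ((coords G)^t* *m coords G).
Proof.
move=> GV; rewrite mxtrace_mulC; apply: eq_bigr => i _.
rewrite (coordsK GV i) onb_norm /qform mulmx1.
by rewrite mul_row_adj -row_mul mxE.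
Qed.

Lemma onb_unitary (U : 'M[C]_d) : U \is unitarymx ->
  orthonormal_basis dot (fun i => T (row i U)) V.
Proof.
move=> Uu; split=> [i j|].
  rewrite dot_synthesisr onb_analysisK.
  by rewrite mul_row_adj -row_mul (unitarymxP Uu) !mxE.
apply/seteqP; split=> [_ [a _ <-]|f].
  by rewrite synthesis_mul; exact: onb_mem.
move=> /onb_synthesisK <-; exists (co f *m U^t*) => //.
by rewrite synthesis_mul -mulmxA unitarymxCP // mulmx1.
Qed.

Lemma mxop_diag (U : 'M[C]_d) l f :
  mxop (U^t* *m rdiag d l *m U) f =
  \sum_(i < d) (nth 0 l i)%:C *: rank1 dot (T (row i U)) f.
Proof.
rewrite /mxop !mulmxA -synthesis_mul; apply: eq_bigr => i _.
rewrite mul_mx_diag mxE [X in _ * X]mxE mulrC -scalerA; congr (_ *: (_ *: _)).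
by rewrite dot_synthesisr mul_row_adj.
Qed.

End Coordinates.

(** * Eigenvalue lists of operators diagonal in an orthonormal basis *)

Section EigenLists.
Variables (R : realType) (H : completeNormedModType R[i]).
Variable dot : {dot H for (@conjC R[i])}.
Local Notation C := R[i].
Variables (d : nat) (V : set H) (x : 'I_d -> H).
Hypothesis onb : orthonormal_basis dot x V.
Variables (l : seq R) (S : H -> H).
Hypothesis S_diag : forall f,
  S f = \sum_(i < d) (nth 0 l i)%:C *: rank1 dot (x i) f.

Local Notation co := (analysis_op dot x).

Lemma diag_synthesis f : S f = synthesis_op x (\row_i ((nth 0 l i)%:C * co f 0 i)).
Proof.
by rewrite S_diag; apply: eq_bigr => i _; rewrite /rank1 scalerA !mxE.
Qed.

Lemma eigenspace_dim (c : R) :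
  has_dim [set f | V f /\ S f = c%:C *: f] #|[set i : 'I_d | nth 0 l i == c]%SET|.
Proof.
set I := [set i : 'I_d | _]%SET.
pose b (j : 'I_#|I|) := x (enum_val j).
have bE a : synthesis_op b a = \sum_(j < #|I|) a 0 j *: x (enum_val j) by [].
have bb i j : dot (b i) (b j) = (i == j)%:R.
  by rewrite /b onb.1 (inj_eq enum_val_inj).
have ab a : analysis_op dot b (synthesis_op b a) = a.
  rewrite analysis_synthesis -[RHS]mulmx1; congr (_ *m _).
  by apply/matrixP => i j; rewrite !mxE bb.
exists b; split; first exact: can_inj ab.
apply/seteqP; split=> [_ [a _ <-]|f [Vf Sf]] /=.
  have Vb : V (synthesis_op b a).
    rewrite -onb.2; exists (a *m \matrix_(j, i) (enum_val j == i)%:R) => //.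
    rewrite -synthesis_mul; apply: eq_bigr => j _; congr (_ *: _).
    rewrite /b -[RHS]synthesis_delta; congr synthesis_op.
    by apply/rowP => i; rewrite !mxE eqxx eq_sym.
  split=> //; rewrite diag_synthesis -[in RHS](onb_synthesisK onb Vb) -linearZ.
  congr synthesis_op; apply/rowP => i; rewrite !mxE.
  have [/eqP-> //|li] := boolP (nth 0 l i == c).
  rewrite linear_sumlz big1 ?mulr0 // => j _.
  rewrite linearZl_LR /= /b onb.1; case: eqP => [ji|]; last by rewrite mulr0.
  by have := enum_valP j; rewrite ji inE (negPf li).
exists (\row_j co f 0 (enum_val j)) => //.
rewrite -[RHS](onb_synthesisK onb Vf) [RHS](bigID (fun i => i \in I)) /=.
rewrite [X in _ + X]big1 ?addr0 => [|i].
  by rewrite big_enum_val; apply: eq_bigr => j _; rewrite !mxE.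
(* Comparing i-th coordinates gives that [l_i - c] times the coordinate of [f] is 0, so the
   coordinates outside [I] vanish. *)
rewrite inE => li; have := congr1 co Sf.
rewrite linearZ diag_synthesis (onb_analysisK onb) => /rowP/(_ i).
rewrite [LHS]mxE [RHS]mxE => /eqP; rewrite -subr_eq0 -mulrBl mulf_eq0.
rewrite -rmorphB /= => /orP[/eqP/complexI/eqP|/eqP ->]; last by rewrite scale0r.
by rewrite subr_eq0 (negPf li).
Qed.

(** For nonzero [c] an eigenvector is a multiple of its image and so lies in [V]. This links
    [is_eigenlist], which looks at all of [H], to the eigenspaces inside [V]. *)
Lemma eigenspace_range (c : R) : c != 0 ->
  [set f | S f = c%:C *: f] = [set f | V f /\ S f = c%:C *: f].
Proof.
move=> c0; apply/seteqP; split=> f /= => [Sf|[]//]; split=> //.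
have -> : f = (c%:C)^-1 *: S f.
  rewrite Sf scalerA mulVf ?scale1r //.
  by apply: contra c0; rewrite fmorph_eq0.
rewrite diag_synthesis -linearZ; exact: (onb_mem onb).
Qed.

Hypotheses (l_size : size l = d) (l_sorted : sorted >=%R l).

Lemma eigenlist_on_diag : eigenlist_on S V d = [ffun i : 'I_d => nth 0 l i].
Proof.
have el : is_eigenlist_on S V [ffun i : 'I_d => nth 0 l i].
  split=> [i j ij|c].
    by rewrite !ffunE sorted_ge_nth // ij l_size ltn_ord.
  have -> : [set i | [ffun i : 'I_d => nth 0 l i] i == c]%SET =
    [set i : 'I_d | nth 0 l i == c]%SET by apply/setP => i; rewrite !inE ffunE.
  exact: eigenspace_dim.
apply: xget_unique => // mu [smu hmu]; apply: sorted_ffun_uniq => //.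
  by case: el.
by move=> c; apply: has_dim_uniq (hmu c) _; exact: el.2.
Qed.

Hypothesis l_ge0 : all (>= 0) l.

Lemma nth_nneg i : 0 <= nth 0 l i.
Proof.
have [il|li] := ltnP i (size l); last by rewrite nth_default.
by move/allP: l_ge0; apply; exact: mem_nth.
Qed.

Lemma nth_nonincreasing : nonincreasing_seq (nth 0 l).
Proof.
move=> i j ij; have [jl|lj] := ltnP j (size l).
  by apply: sorted_ge_nth; rewrite // ij.
by rewrite [leLHS]nth_default // nth_nneg.
Qed.

Lemma series_nth_near : \forall k \near \oo, series (nth 0 l) k = \sum_(z <- l) z.
Proof.
exists (size l) => // k /= lk.
have tail : \sum_(size l <= i < k) nth 0 l i = 0.
  by rewrite big_nat big1 // => i /andP[li _]; rewrite nth_default.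
by rewrite /series /= (big_cat_nat (leq0n _) lk) /= tail addr0 [RHS](big_nth 0).
Qed.

Lemma lim_series_nth : limn (series (nth 0 l)) = \sum_(z <- l) z.
Proof. exact: norm_lim_near_cst series_nth_near. Qed.

Lemma nth_l1_dec : l1_dec H (nth 0 l).
Proof.
split; [exact: nth_nneg|exact: nth_nonincreasing| |].
  exact: is_cvg_near_cst series_nth_near.
move=> i; apply: contra_notP => /eqP li0.
have id : (i < d)%N.
  by rewrite -l_size ltnNge; apply: contra li0 => /(nth_default 0) ->.
pose b (j : 'I_i.+1) := x (widen_ord id j); exists b.
apply: (can_inj (g := analysis_op dot b)) => a.
rewrite analysis_synthesis -[RHS]mulmx1; congr (_ *m _).
apply/matrixP => j k; rewrite !mxE /b onb.1.
by congr (_%:R); congr nat_of_bool; apply/eqP/eqP => [[/val_inj]|->].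
Qed.

Lemma eigenlist_diag : eigenlist S = nth 0 l.
Proof.
pose J (c : R) := [set i : 'I_d | nth 0 l i == c]%SET.
(* The default value 0 of [nth] past the end of [l] is never counted, since [c] is positive. *)
have card_l (c : R) : 0 < c -> [set i | nth 0 l i = c] #= `I_#|J c|.
  move=> c0.
  have -> : [set i | nth 0 l i = c] =
      [set val (enum_val j) | j in [set: 'I_#|J c|]].
    apply/seteqP; split=> [i /= ic|_ [j _ <-] /=].
      have il : (i < d)%N.
        rewrite -l_size ltnNge; apply/negP => li.
        by rewrite -ic nth_default // ltxx in c0.
      have iI : Ordinal il \in J c by rewrite inE ic.
      by exists (enum_rank_in iI (Ordinal il)); rewrite ?enum_rankK_in.
    by have := enum_valP j; rewrite inE => /eqP.
  apply: card_eq_trans (inj_card_eq _) _; last by rewrite card_eq_sym card_II.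
  by move=> i j _ _ /val_inj/enum_val_inj.
have el : is_eigenlist S (nth 0 l : nat -> R).
  split=> [|c c0]; first exact: nth_l1_dec.
  exists #|J c|; split; last exact: card_l.
  by rewrite eigenspace_range ?gt_eqF //; exact: eigenspace_dim.
apply: xget_unique => // u [[u0 un _ _] hu].
apply: eqlist_uniq => //; [exact: nth_nonincreasing|exact: nth_nneg|].
move=> c c0; have [k [dk uk]] := hu c c0; exists k; split=> //.
have [_ /(_ c c0)[k' [dk' lk']]] := el.
by rewrite (has_dim_uniq dk dk').
Qed.

End EigenLists.

(** * Oblique duals in coordinates *)

Section Duals.
Variables (R : realType) (H : completeNormedModType R[i]).
Variable dot : {dot H for (@conjC R[i])}.
Local Notation C := R[i].
Variables (V W : set H) (d n : nat) (e w : 'I_d -> H).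
Hypotheses (onbV : orthonormal_basis dot e V) (onbW : orthonormal_basis dot w W).
Hypothesis HVW : direct_sum_decomp (orthocompl dot W) V.
Variable F : 'I_n -> H.
Hypothesis HF : frame_for F W.

Definition cross_gram : 'M[C]_(d, n) := \matrix_(k, i) dot (e k) (F i).
Local Notation Phi := cross_gram.

Lemma frame_mem i : W (F i).
Proof. by rewrite -HF; exact: span_mem. Qed.

(** Right multiplication by [Phi] sends the coordinates of [g] to its inner products with [F], so
    reconstruction on [V] reads [a *m Phi *m G = a] for all rows [a]. *)
Lemma oblique_dualP (G : 'I_n -> H) : (forall i, V (G i)) ->
  oblique_dual dot V F G <-> Phi *m coords dot e G = 1%:M.
Proof.
move=> GV; have GE a : \sum_(i < n) dot (synthesis_op e a) (F i) *: G i =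
    synthesis_op e (a *m (Phi *m coords dot e G)).
  rewrite mulmxA -(synthesis_coords onbV _ GV) -analysis_synthesis.
  by apply: eq_bigr => i _; rewrite mxE.
split=> [[_ h]|h].
  apply: mulmx_eq1 => a; apply: (onb_inj onbV).
  by rewrite -GE -h //; exact: (onb_mem onbV).
split=> // g /(onb_synthesisK onbV) <-.
by rewrite GE h mulmx1.
Qed.

Lemma oblique_dual_span (G : 'I_n -> H) :
  oblique_dual dot V F G -> lin_span G = V.
Proof.
move=> [GV h]; apply/seteqP; split=> [_ [a _ <-]|g /h ->].
  by rewrite (synthesis_coords onbV _ GV); exact: (onb_mem onbV).
exists (\row_i dot g (F i)) => //.
by apply: eq_bigr => i _; rewrite mxE.
Qed.

Lemma unitmx_inj k (M : 'M[C]_k) : (forall a : 'rV_k, a *m M = 0 -> a = 0) ->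
  M \in unitmx.
Proof. by move=> h; rewrite -row_free_unit; exact: inj_row_free. Qed.

(** A row killed by this matrix is the coordinate row of an element of [V] orthogonal to [W], hence
    0. *)
Lemma cross_gram_unit : (\matrix_(k, j) dot (e k) (w j) : 'M[C]_d) \in unitmx.
Proof.
apply: unitmx_inj => a; rewrite -analysis_synthesis => /(orthocomplP onbW) h.
have : (orthocompl dot W `&` V) (synthesis_op e a).
  by split=> //; exact: (onb_mem onbV).
by rewrite HVW.2 /= -[0](linear0 (synthesis_op e)) => /(onb_inj onbV).
Qed.

Lemma oblique_projE a : oblique_proj V (orthocompl dot W) (synthesis_op w a) =
  synthesis_op e (a *m invmx (\matrix_(k, j) dot (e k) (w j))).
Proof.
set v := RHS; apply: xget_unique => /= [|v' [Vv' Wv']].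
  split; first exact: (onb_mem onbV).
  apply/(orthocomplP onbW).
  by rewrite linearB /= (onb_analysisK onbW) analysis_synthesis mulmxKV
    ?cross_gram_unit ?subrr.
apply/eqP; rewrite -subr_eq0; apply/eqP.
suff : (orthocompl dot W `&` V) (v' - v) by rewrite HVW.2.
split.
  apply/(orthocomplP onbW); rewrite linearB /=; apply/eqP; rewrite subr_eq0.
  have /(orthocomplP onbW)/eqP := Wv'; rewrite linearB /= subr_eq0 => /eqP <-.
  by rewrite (onb_analysisK onbW) analysis_synthesis mulmxKV ?cross_gram_unit.
rewrite -(onb_synthesisK onbV Vv') /v -linearB; exact: (onb_mem onbV).
Qed.

(** Since [F] spans [W], the matrix [Psi] has a left inverse, so [a *m Psi^t* = 0] forces
    [a = 0]. *)
Lemma frame_gram_unit : ((coords dot w F)^t* *m coords dot w F) \in unitmx.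
Proof.
set Psi := coords dot w F.
have [M hM] : exists M : 'M[C]_(d, n), M *m Psi = 1%:M.
  have [|M hM] := @span_coeffs _ _ _ _ F w.
    by move=> i; rewrite HF -onbW.2; exact: span_mem.
  exists M; apply: mulmx_eq1 => a; apply: (onb_inj onbW).
  rewrite mulmxA -(synthesis_coords onbW _ frame_mem) -synthesis_mul.
  by rewrite -(funext hM).
apply: unitmx_inj => a h.
have /eqP : qform (Psi^t* *m Psi) a = 0 by rewrite /qform h mul0mx mxE.
rewrite qform_gram qform1_eq0 => /eqP aP.
by rewrite -[a]mulmx1 -adjmx1 -hM adjmxM mulmxA aP mul0mx.
Qed.

(** Both products of the two operators equal the orthogonal projection onto [W], from which the
    Penrose equations follow. *)
Lemma pinv_frame_op : Defs.pinv dot (frame_op dot F) =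
  mxop dot w (invmx ((coords dot w F)^t* *m coords dot w F)).
Proof.
set M := _ *m _; have Mu : M \in unitmx := frame_gram_unit.
rewrite (frame_op_coords onbW frame_mem) -/M.
have Mh : M^t* = M by rewrite /M adjmxM trmxCK.
suff pM : is_pinv dot (mxop dot w M) (mxop dot w (invmx M)).
  by apply: xget_unique => // X pX; exact: is_pinv_unique pX pM.
have sa1 : self_adjoint dot (mxop dot w 1%:M).
  by move=> f g; rewrite mxop_adj adjmx1.
split; first exact: mxop_linear.
split=> [f|f||].
- by rewrite !(mxop_comp onbW) mulVmx // mulmx1.
- by rewrite !(mxop_comp onbW) mulmxV // mulmx1.
- by move=> f g /=; rewrite !(mxop_comp onbW) mulVmx //; exact: sa1.
- by move=> f g /=; rewrite !(mxop_comp onbW) mulmxV //; exact: sa1.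
Qed.

Lemma canonical_dual_coords : exists G0 : 'M[C]_(n, d), exists K : 'M[C]_d,
  [/\ canonical_dual dot V W F = (fun i => synthesis_op e (row i G0)),
      Phi *m G0 = 1%:M & G0 = Phi^t* *m K].
Proof.
set Psi := coords dot w F.
pose E : 'M[C]_d := \matrix_(k, j) dot (e k) (w j).
pose M := Psi^t* *m Psi.
have Eu : E \in unitmx := cross_gram_unit.
have Mu : M \in unitmx := frame_gram_unit.
have PhiE : Phi = E *m Psi^t*.
  apply/matrixP => k i; rewrite mxE (coordsK onbW frame_mem i) dot_synthesisr.
  by rewrite mul_row_adj -row_coords -row_mul mxE.
have [PG eG] := pinv_dual_matrix Eu Mu.
exists (Psi *m invmx M *m invmx E), (invmx (E^t*) *m invmx M *m invmx E).
rewrite PhiE; split=> //; apply: funext => i.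
rewrite /canonical_dual pinv_frame_op /mxop oblique_projE.
by rewrite -row_coords -!row_mul.
Qed.

(* The cross terms vanish because [G0] lies in the range of [Phi^*] while
   [Phi] kills the difference of two duals. *)
Lemma gram_dual_decomp (G G0 : 'M[C]_(n, d)) K :
  Phi *m G = 1%:M -> Phi *m G0 = 1%:M -> G0 = Phi^t* *m K ->
  G^t* *m G = G0^t* *m G0 + (G - G0)^t* *m (G - G0).
Proof.
move=> PG PG0 eG0; set Z := G - G0.
have PZ : Phi *m Z = 0 by rewrite mulmxBr PG PG0 subrr.
have G0Z : G0^t* *m Z = 0 by rewrite eG0 adjmxM trmxCK -mulmxA PZ mulmx0.
have ZG0 : Z^t* *m G0 = 0.
  by rewrite -[G0]trmxCK -adjmxM G0Z trmx0 map_mx0.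
have eG : G = G0 + Z by rewrite addrC subrK.
by clearbody Z; rewrite eG adjmxD mulmxDl !mulmxDr G0Z ZG0 addr0 add0r.
Qed.

(** The columns of the difference lie in the kernel of [Phi], whose dimension is [n - d]. *)
Lemma rank_dual_diff (G G0 : 'M[C]_(n, d)) :
  Phi *m G = 1%:M -> Phi *m G0 = 1%:M -> (\rank (G - G0)%R <= n - d)%N.
Proof.
move=> PG PG0; have /eqP rP : row_free Phi by apply/row_freeP; exists G0.
have : Phi *m (G - G0) = 0 by rewrite mulmxBr PG PG0 subrr.
have dn : (d <= n)%N by have := rank_leq_col Phi; rewrite rP.
by move=> /mulmx0_rank_max; rewrite rP leq_subRL.
Qed.

Lemma spec_gram_ge0 k (Z : 'M[C]_(k, d)) l : spec (Z^t* *m Z) l -> all (>= 0) l.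
Proof.
move=> sZ; have sl := spec_size sZ; have [U Uu eZ] := spec_diag sZ.
apply/(all_nthP 0) => i; rewrite sl => id.
have := qform1_ge0 (row (Ordinal id) U *m Z^t*).
rewrite -qform_gram eZ qform_diag -row_mul (unitarymxP Uu).
rewrite (bigD1 (Ordinal id)) //= big1 ?addr0 => [|j ji].
  by rewrite !mxE eqxx normr1 expr1n mulr1 ler0c.
by rewrite !mxE eq_sym (negPf ji) normr0 expr0n mulr0.
Qed.

Lemma sum_sqr_norm (G : 'I_n -> H) l : (forall x : H, `|x| ^+ 2 = dot x x) ->
  (forall i, V (G i)) -> spec ((coords dot e G)^t* *m coords dot e G) l ->
  \sum_(i < n) `|G i| ^+ 2 = (\sum_(z <- l) z)%:C.
Proof.
move=> Hn GV sG; rewrite -(spec_trace sG) -(sum_dot_coords onbV GV).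
by apply: eq_bigr => i _; rewrite Hn.
Qed.

Lemma eigenlist_spec (M : 'M[C]_d) l : spec M l -> sorted >=%R l ->
  all (>= 0) l -> eigenlist (mxop dot e M) = nth 0 l.
Proof.
move=> sM sl l0; have [U Uu eM] := spec_diag sM.
apply: (eigenlist_diag (onb_unitary onbV Uu)) => // [f|]; last exact: spec_size sM.
by rewrite eM mxop_diag.
Qed.

Lemma convex_potential_spec h (G : 'I_n -> H) l : oblique_dual dot V F G ->
  spec ((coords dot e G)^t* *m coords dot e G) l -> sorted >=%R l ->
  convex_potential dot h G = \sum_(i < d) h (nth 0 l i).
Proof.
move=> dG sG sl; rewrite /convex_potential (oblique_dual_span dG).
rewrite (dim_ofE (onb_dim onbV)) (frame_op_coords onbV dG.1).
by rewrite (eigenlist_spec sG sl (spec_gram_ge0 sG)).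
Qed.

Lemma onb_rev (x : 'I_d -> H) : orthonormal_basis dot x V ->
  orthonormal_basis dot (x \o @rev_ord d) V.
Proof.
move=> onb; split=> [i j /=|]; first by rewrite onb.1 (inj_eq rev_ord_inj).
have E a : synthesis_op (x \o @rev_ord d) a =
    synthesis_op x (\row_i a 0 (rev_ord i)).
  rewrite /synthesis_op (reindex_inj rev_ord_inj); apply: eq_bigr => i _ /=.
  by rewrite mxE rev_ordK.
apply/seteqP; split=> [_ [a _ <-]|f].
  by rewrite E; exact: (onb_mem onb).
rewrite -onb.2 => -[a _ <-]; exists (\row_i a 0 (rev_ord i)) => //.
by rewrite E; congr synthesis_op; apply/rowP => i; rewrite !mxE rev_ordK.
Qed.

(** [eigenlist_on] is nonincreasing while [l] is nondecreasing; reversing the basis aligns them. *)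
Lemma eigenlist_on_rev (x : 'I_d -> H) (S : H -> H) l :
  orthonormal_basis dot x V -> size l = d -> sorted <=%R l ->
  (forall f, S f = \sum_(i < d) (nth 0 l i)%:C *: rank1 dot (x i) f) ->
  forall i : 'I_d, eigenlist_on S V d (rev_ord i) = nth 0 l i.
Proof.
move=> onb sl lsort hS i.
rewrite (eigenlist_on_diag (onb_rev onb) (l := rev l)).
- by rewrite ffunE nth_rev ?sl //; congr nth; rewrite /= subnSK // subKn // ltnW.
- move=> f; rewrite hS (reindex_inj rev_ord_inj); apply: eq_bigr => j _ /=.
  by rewrite nth_rev ?sl.
- by rewrite size_rev.
- by rewrite rev_sorted.
Qed.

(** At most [n - d] increments are nonzero, so their square roots fit into a matrix [Y] with [n - d]
    rows, which an orthonormal basis of the kernel of [Phi] carries to an admissible [Z] without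
    changing the Gram matrix. *)
Lemma exists_dual_increment (G0 : 'M[C]_(n, d)) (U : 'M[C]_d) c a :
  Phi *m G0 = 1%:M -> size a = d ->
  exists2 Z : 'M[C]_(n, d), Phi *m Z = 0 &
    Z^t* *m Z = U^t* *m rdiag d (pad c (n - d) a) *m U.
Proof.
move=> PG0 sa; have /eqP rP : row_free Phi by apply/row_freeP; exists G0.
have [N Nu PN] := unitary_kernel rP.
pose p i : C := (nth 0 (pad c (n - d) a) i)%:C.
have p0 i : 0 <= p i by rewrite ler0c pad_ge0.
have cp i : conjC (sqrtC (p i)) = sqrtC (p i).
  by apply/CrealP/ger0_real; rewrite sqrtC_ge0.
(* Row [k] holds the root of the increment of index [d - 1 - k], if there is one. No two columns
   share a nonzero row, so the Gram matrix of [Y] is diagonal; columns of index below [d - (n - d)]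
   meet no row, but their increment is 0. *)
pose Y : 'M[C]_(n - d, d) :=
    \matrix_(k, i) (((i + k).+1 == d)%:R * sqrtC (p i)).
exists (N^t* *m Y *m U); first by rewrite !mulmxA PN !mul0mx.
rewrite !adjmxM trmxCK !mulmxA; congr (_ *m _).
rewrite -[_ *m N *m N^t*]mulmxA (unitarymxP Nu) mulmx1 -mulmxA; congr (_ *m _).
apply/matrixP => i j; rewrite mxE [RHS]mxE mxE.
have [->|ij] := eqVneq i j; last first.
  rewrite mulr0n big1 // => k _; rewrite adjmxE !mxE.
  case: eqP => ik; last by rewrite mul0r rmorph0 mul0r.
  case: eqP => jk; last by rewrite mul0r mulr0.
  by case/eqP: ij; apply: val_inj => /=; lia.
rewrite mulr1n; have [jm|mj] := ltnP j (d - (n - d)).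
  rewrite pad_eq0 ?sa // big1 // => k _; rewrite adjmxE !mxE.
  by rewrite /p pad_eq0 ?sa // sqrtC0 !mulr0.
have kn : (d - j.+1 < n - d)%N by have := ltn_ord j; lia.
rewrite (bigD1 (Ordinal kn)) //= big1 ?addr0 => [|k /eqP nk].
  rewrite adjmxE !mxE /= (_ : (_ == _) = true); last first.
    by apply/eqP; have := ltn_ord j; lia.
  by rewrite mul1r cp -expr2 sqrtCK.
rewrite adjmxE !mxE; case: eqP => jk; last by rewrite mul0r rmorph0 mul0r.
by case: nk; apply: val_inj => /=; lia.
Qed.

End Duals.

(** If [d = 0] or [d = n], the canonical dual is the only dual, and none reaches a [t] above its
    trace; the second condition on [t] excludes this case, in which the constraint set is empty. *)
Theorem theorem3p11 (R : realType) (H : completeNormedModType R[i])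
    (dot : {dot H for (@conjC R[i])})
    (Hnorm : forall x : H, `|x| ^+ 2 = dot x x)
    (Hsep : exists D : set H, countable D /\ dense D)
    (V W : set H) (d n : nat)
    (HdimV : has_dim V d) (HdimW : has_dim W d)
    (HVW : direct_sum_decomp (orthocompl dot W) V)
    (F : 'I_n -> H) (HF : frame_for F W) (t : R) :
  let S_can := frame_op dot (canonical_dual dot V W F) in
  let lam_can := eigenlist S_can in
  limn (series lam_can) <= t ->
  (limn (series lam_can) < t -> (0 < d < n)%N) ->
  exists nu : nat -> R, l1_dec H nu /\
  exists Gop : 'I_n -> H,
    [/\ oblique_dual_ge dot V t F Gop,
        eigenlist (frame_op dot Gop) = nu
      & forall h : R -> R, Conv h -> nondecreasing_nneg h ->
        (forall G : 'I_n -> H, oblique_dual_ge dot V t F G ->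
           convex_potential dot h Gop <= convex_potential dot h G) /\
        (strictly_convex_nneg h ->
         forall G : 'I_n -> H, oblique_dual_ge dot V t F G ->
           convex_potential dot h Gop = convex_potential dot h G ->
           eigenlist (frame_op dot G) = nu /\
           let B := fun f : H => frame_op dot G f - S_can f in
           exists x : 'I_d -> H,
             [/\ orthonormal_basis dot x V,
                 forall f, S_can f =
                   \sum_(i < d) (lam_can i)%:C *: rank1 dot (x i) f
               & forall f, B f =
                   \sum_(i < d)
                     (eigenlist_on B V d (rev_ord i))%:C *: rank1 dot (x i) f])].
Proof.
move=> S_can lam_can ht hdeg.
have [e onbV] := exists_onb dot HdimV; have [w onbW] := exists_onb dot HdimW.
have [G0 [K [eG0 PG0 G0K]]] := canonical_dual_coords onbV onbW HVW HF.
set Phi := cross_gram dot e F in PG0 G0K.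
pose A := G0^t* *m G0.
have [a sA sa] : exists2 a : seq R, spec A a & sorted >=%R a.
  by apply: sort_spec_exists; rewrite /A adjmxM trmxCK.
have za := spec_size sA; have a0 := spec_gram_ge0 sA.
have S_canE : S_can = mxop dot e A.
  rewrite /S_can eG0 (frame_op_coords onbV) ?(coords_synthesis onbV) //.
  by move=> i; exact: onb_mem onbV _.
have lamE : lam_can = nth 0 a by rewrite /lam_can S_canE (eigenlist_spec onbV sA).
have limE : limn (series lam_can) = \sum_(z <- a) z by rewrite lamE lim_series_nth.
rewrite limE in ht hdeg.
(* [m] bounds the rank of a perturbation and [T] is the trace it has to add. *)
pose m := (n - d)%N; pose T := t - \sum_(z <- a) z.
have [||c c0 fill_sum] := @exists_water_level R m a T a0; first by rewrite subr_ge0.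
  rewrite subr_gt0 => /hdeg/andP[d0 dn]; split; last by rewrite subn_gt0.
  by rewrite -size_eq0 za -lt0n.
have {}fill_sum : \sum_(z <- fill c m a) z = t by rewrite fill_sum addrC subrK.
(* The clamped form of the optimal spectrum is sorted and fits Weyl's intervals; its permutation
   [fill c m a] is the form that a dual attains. *)
pose nul := mkseq (clamp c m a) d.
have nul_size : size nul = d by rewrite size_mkseq.
have nul_perm : perm_eq nul (fill c m a) by rewrite /nul -za; exact: clamp_perm.
have nul_sorted : sorted >=%R nul.
  apply/(sortedP 0) => i; rewrite nul_size => id.
  rewrite !nth_mkseq ?(ltnW id) //; apply: clamp_nonincreasing => //.
  by rewrite za leqnSn.
have a_ge0 i : 0 <= nth 0 a i by exact: nth_nneg.
have nul_ge0 : all (>= 0) nul.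
  by apply/allP => z /mapP[i _ ->]; rewrite /clamp le_max a_ge0.
exists (nth 0 nul); split; first exact: (nth_l1_dec onbV nul_size).
(* A competitor enters only through its perturbation [Z] and the sorted spectrum [x] of the
   perturbed matrix. *)
have dualE (G : 'I_n -> H) : oblique_dual_ge dot V t F G ->
    exists Z : 'M[R[i]]_(n, d), exists2 x : seq R,
    [/\ (\rank Z <= m)%N, spec (A + Z^t* *m Z) x, sorted >=%R x & all (>= 0) x] &
    [/\ frame_op dot G = mxop dot e (A + Z^t* *m Z), t <= \sum_(z <- x) z
      & forall h, convex_potential dot h G = \sum_(i < d) h (nth 0 x i)].
  move=> [dG tG]; have PG := (oblique_dualP onbV F dG.1).1 dG.
  pose Z := coords dot e G - G0.
  have eM := gram_dual_decomp PG PG0 G0K; rewrite -/A -/Z in eM.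
  have [x sX sx] : exists2 x : seq R, spec (A + Z^t* *m Z) x & sorted >=%R x.
    by apply: sort_spec_exists; rewrite -eM adjmxM trmxCK.
  have sM := sX; rewrite -eM in sM.
  exists Z, x; split.
  - exact: rank_dual_diff PG PG0.
  - exact: sX.
  - exact: sx.
  - exact: spec_gram_ge0 sM.
  - by rewrite (frame_op_coords onbV dG.1) eM.
  - by rewrite -lecR -(sum_sqr_norm onbV Hnorm dG.1 sM).
  - by move=> h; exact: (convex_potential_spec onbV h dG sM sx).
have [U Uu eA] := spec_diag sA.
have [Z PZ eZ] := exists_dual_increment U c PG0 za.
pose Gop i := synthesis_op e (row i (G0 + Z)).
have GopV i : V (Gop i) by exact: onb_mem onbV _.
have Gop_coords : coords dot e Gop = G0 + Z.
  exact: (coords_synthesis onbV (G0 + Z)).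
have PGop : Phi *m coords dot e Gop = 1%:M.
  by rewrite Gop_coords mulmxDr PG0 PZ addr0.
have sGop : spec ((coords dot e Gop)^t* *m coords dot e Gop) nul.
  rewrite (gram_dual_decomp PGop PG0 G0K) -/A Gop_coords [G0 + Z]addrC addrK eZ.
  apply: (@spec_perm _ _ _ (fill c m a)); first by rewrite perm_sym.
  (* The increments are added along the eigenvectors of [A], so the eigenvalues simply add up. *)
  have -> : A + U^t* *m rdiag d (pad c m a) *m U =
      U^t* *m rdiag d (fill c m a) *m U.
    rewrite {1}eA -mulmxDl -mulmxDr /rdiag -linearD; congr (_ *m diag_mx _ *m _).
    by apply/rowP => i; rewrite !mxE nth_pad -rmorphD addrC subrK.
  by apply: diag_spec; rewrite // size_fill.
have dGop : oblique_dual_ge dot V t F Gop.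
  split; first exact/(oblique_dualP onbV).
  rewrite (sum_sqr_norm onbV Hnorm GopV sGop) lecR.
  by rewrite (perm_big _ nul_perm) fill_sum.
exists Gop; split=> //.
  by rewrite (frame_op_coords onbV GopV) (eigenlist_spec onbV sGop).
move=> h hc hn.
have PGopE : convex_potential dot h Gop = \sum_(i < d) h (clamp c m a i).
  rewrite (convex_potential_spec onbV _ dGop.1 sGop nul_sorted).
  by apply: eq_bigr => i _; rewrite nth_mkseq.
have between (G : 'I_n -> H) (Z' : 'M[R[i]]_(n, d)) (x : seq R) :
    (\rank Z' <= m)%N -> spec (A + Z'^t* *m Z') x -> sorted >=%R x ->
    all (>= 0) x -> t <= \sum_(z <- x) z ->
    \sum_(i < d) h (clamp c m a i) <= \sum_(i < d) h (nth 0 x i) /\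
    (strictly_convex_nneg h -> \sum_(i < d) h (clamp c m a i) =
      \sum_(i < d) h (nth 0 x i) -> forall i : 'I_d, clamp c m a i = nth 0 x i).
  move=> rZ sX sx x0 tx; have zx := spec_size sX.
  apply: (@sum_between _ _ d c _ (fun i => nth 0 x i)) => //.
  - by move=> i; exact: nth_nneg.
  - move=> i; apply: clamp_between; first exact: weyl_monotone sA sa sX sx _.
    by move=> mi; apply: weyl_rank sA sa sX sx rZ _; rewrite mi ltn_ord.
  - have -> : \sum_(i < d) clamp c m a i = t.
      rewrite -fill_sum -(perm_big _ nul_perm) /nul /mkseq big_map.
      by rewrite -(big_mkord xpredT (clamp c m a)) /index_iota subn0.
    by apply: le_trans tx _; rewrite (big_nth 0) zx big_mkord.
split=> [G dG|hsc G dG].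
  have [Z' [x [rZ sX sx x0] [_ tx ->]]] := dualE G dG; rewrite PGopE.
  by have [] := between G Z' x rZ sX sx x0 tx.
have [Z' [x [rZ sX sx x0] [eG tx ->]]] := dualE G dG; rewrite PGopE => eq_pot.
have zx := spec_size sX.
have xE : x = nul.
  have [_ /(_ hsc eq_pot) ex] := between G Z' x rZ sX sx x0 tx.
  apply: (@eq_from_nth _ 0); rewrite ?nul_size // zx => i id.
  by rewrite nth_mkseq // -(ex (Ordinal id)).
rewrite xE in sX.
split; first by rewrite eG (eigenlist_spec onbV sX).
(* Strict convexity has forced the spectrum of the competitor to be [nul], so the structure theorem
   diagonalises [A] and the perturbation simultaneously. *)
move=> B; have [U' [Uu' eA' eZ']] :=
  optimal_structure sa rZ sA (spec_perm nul_perm sX).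
have BE f : B f = mxop dot e (Z'^t* *m Z') f.
  by rewrite /B eG S_canE -mxopB addrAC subrr add0r.
pose x' i := synthesis_op e (row i U').
have onbx : orthonormal_basis dot x' V by exact: onb_unitary onbV _ Uu'.
have B_diag f : B f = \sum_(i < d) (nth 0 (pad c m a) i)%:C *: rank1 dot (x' i) f.
  by rewrite BE eZ' mxop_diag.
exists x'; split=> // f.
  by rewrite S_canE lamE {1}eA' mxop_diag.
rewrite B_diag; apply: eq_bigr => i _.
rewrite (eigenlist_on_rev onbx _ _ B_diag) ?size_pad //.
apply/(sortedP 0) => j; rewrite size_pad => ja.
by apply: pad_nondecreasing; rewrite // leqnSn.
Qed.
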